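(* Let $f$ be a multi-valued function on represented spaces. Then the following are equivalent: (1) $f\leq_{\mathrm W}\widehat{\mathsf{C}_{\mathbb{N}}}$; (2) $f$ is limit computable.
   Context: Baire space is $\mathbb{N}^{\mathbb{N}}$, with its usual product topology, a fixed computable bijective pairing $\langle\cdot,\cdot\rangle$ and the canonical countable tupling $\langle p_0,p_1,p_2,\ldots\rangle$ on it. Computability of partial functions $F:\subseteq\mathbb{N}^{\mathbb{N}}\to\mathbb{N}^{\mathbb{N}}$ is meant via (type-2) Turing machines. A representation of a set $X$ is a surjective partial function $\delta:\subseteq\mathbb{N}^{\mathbb{N}}\to X$; $(X,\delta)$ is a represented space. $f:\subseteq X\rightrightarrows Y$ denotes a partial multi-valued function ($f(x)\neq\emptyset$ for $x\in\mathrm{dom}(f)$). A realizer of $f:\subseteq(X,\delta_X)\rightrightarrows(Y,\delta_Y)$, written $F\vdash f$, is a single-valued $F:\subseteq\mathbb{N}^{\mathbb{N}}\to\mathbb{N}^{\mathbb{N}}$ with $\delta_Y F(p)\in f\delta_X(p)$ for all $p\in\mathrm{dom}(f\delta_X)$; $f$ is $(\delta_X,\delta_Y)$-computable if it has a computable realizer with respect to these representations. Weihrauch reducibility $f\leq_{\mathrm W}g$ means: there are computable $K,H:\subseteq\mathbb{N}^{\mathbb{N}}\to\mathbb{N}^{\mathbb{N}}$ such that $p\mapsto K\langle p,GH(p)\rangle$ is a realizer of $f$ for every $G\vdash g$. $\mathbb{N}$ has the representation $\delta_{\mathbb{N}}(p)=p(0)$. $\mathcal{A}_-(\mathbb{N})$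 is the set of subsets of $\mathbb{N}$ with the representation $\psi_-^{\mathbb{N}}(p)=\{n\in\mathbb{N}:n+1\notin\mathrm{range}(p)\}$. Closed choice on $\mathbb{N}$ is $\mathsf{C}_{\mathbb{N}}:\subseteq\mathcal{A}_-(\mathbb{N})\rightrightarrows\mathbb{N},\ A\mapsto A$ with domain the non-empty sets (any element of $A$ is an admissible output). The parallelization of $f:\subseteq X\rightrightarrows Y$ is $\widehat{f}:\subseteq X^{\mathbb{N}}\rightrightarrows Y^{\mathbb{N}}$, $\widehat{f}((x_i)_{i\in\mathbb{N}})=\prod_{i=0}^\infty f(x_i)$, where a name of a sequence $(x_i)_i$ is $\langle p_0,p_1,\ldots\rangle$ with $p_i$ a name of $x_i$. The limit map is $\lim:\subseteq\mathbb{N}^{\mathbb{N}}\to\mathbb{N}^{\mathbb{N}},\ \langle p_0,p_1,\ldots\rangle\mapsto\lim_{i\to\infty}p_i$ (limit in the usual Baire topology). For a representation $\delta$, put $\delta'(p)=\delta(\lim p)$. $f:\subseteq(X,\delta_X)\rightrightarrows(Y,\delta_Y)$ is limit computable if it is $(\delta_X,\delta_Y')$-computable. *)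

(* Defs.v *)
From HB Require Import structures.
From Stdlib Require Cantor.
From mathcomp Require Import all_boot.
From mathcomp Require Import all_classical.
From mathcomp Require Import topology.

Set Implicit Arguments.
Unset Strict Implicit.
Unset Printing Implicit Defensive.

Local Open Scope classical_set_scope.

(* Single-valued partial functions A -> B are given by their graphs, so that
   domains need not be decidable. *)
Record pfun (A B : Type) := PFun {
  graph :> A -> set B;
  graph_fun : forall a, is_subset1 (graph a) }.

Lemma pcomp_subproof (A B C : Type) (G : pfun B C) (F : pfun A B) (a : A) :
  is_subset1 [set c | exists2 b, F a b & G b c].
Proof.
move=> c c' [b Fab Gbc] [b' Fab' Gbc'].
by rewrite (graph_fun Fab' Fab) in Gbc'; exact: graph_fun Gbc Gbc'.
Qed.

Definition pcomp (A B C : Type) (G : pfun B C) (F : pfun A B) : pfun A C :=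
  PFun (@pcomp_subproof A B C G F).

Definition baire : Type := prod_topology (fun _ : nat => nat).

HB.instance Definition _ := Pointed.on baire.
HB.instance Definition _ := Nbhs.on baire.
HB.instance Definition _ := Topological.on baire.

Lemma baire_hausdorff : hausdorff_space baire.
Proof. by apply: hausdorff_product => ?; exact: discrete_hausdorff. Qed.

(* <p, q>(2n) = p(n) and <p, q>(2n + 1) = q(n). *)
Definition pairing (p q : baire) : baire :=
  fun n => if odd n then q n./2 else p n./2.

(* <p_0, p_1, ...>(<i, j>) = p_i(j), with the Cantor pairing <i, j>. *)
Definition tupling (ps : nat -> baire) : baire :=
  fun n => let: (i, j) := Cantor.of_nat n in ps i j.

Definition component (p : baire) (i : nat) : baire :=
  fun j => p (Cantor.to_nat (i, j)).

Lemma tuplingK : cancel tupling component.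
Proof.
move=> ps; apply/funext => i; apply/funext => j.
by rewrite /component /tupling Cantor.cancel_of_to.
Qed.

Lemma componentK : cancel component tupling.
Proof.
move=> p; apply/funext => n; rewrite /component /tupling.
by case E: (Cantor.of_nat n) => [i j]; rewrite -E Cantor.cancel_to_of.
Qed.

(* Type-2 Turing machines: a one-way read-only input tape and a one-way
   write-only output tape over {0, 1} (true is the symbol 1), and finitely
   many work tapes, infinite to the right, on which a left move from cell 0
   has no effect. The machine never halts; halting amounts to looping without
   output. *)
Inductive move := MoveLeft | Stay | MoveRight.

Record action (state symbol : Type) (k : nat) := Action {
  next_state : state;
  advance_input : bool;
  written : 'I_k -> symbol;
  moved : 'I_k -> move;
  emitted : option bool }.

Record machine := Machine {
  state : finType;
  symbol : finType;
  tapes : nat;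
  start : state;
  blank : symbol;
  transition :
    state -> bool -> {ffun 'I_tapes -> symbol} -> action state symbol tapes }.

Record config (M : machine) := Config {
  cur_state : state M;
  input_head : nat;
  content : 'I_(tapes M) -> nat -> symbol M;
  head : 'I_(tapes M) -> nat;
  output : seq bool }.

Definition move_head (m : move) (h : nat) : nat :=
  match m with MoveLeft => h.-1 | Stay => h | MoveRight => h.+1 end.

Definition step (M : machine) (input : nat -> bool) (c : config M) : config M :=
  let a := transition (cur_state c) (input (input_head c))
             [ffun i => content c i (head c i)] in
  {| cur_state := next_state a;
     input_head := advance_input a + input_head c;
     content := fun i n =>
       if n == head c i then written a i else content c i n;
     head := fun i => move_head (moved a i) (head c i);
     output := output c ++ seq_of_opt (emitted a) |}.

Definition init (M : machine) : config M :=
  {| cur_state := start M;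
     input_head := 0;
     content := fun _ _ => blank M;
     head := fun _ => 0;
     output := [::] |}.

(* A point p of Baire space is written on a tape as the infinite word
   1^p(0) 0 1^p(1) 0 1^p(2) 0 ... *)
Definition word_prefix (p : baire) (n : nat) : seq bool :=
  flatten [seq rcons (nseq (p i) true) false | i <- iota 0 n].

(* word_prefix p m.+1 has length greater than m. *)
Definition word (p : baire) (m : nat) : bool := nth false (word_prefix p m.+1) m.

Definition run (M : machine) (p : baire) (t : nat) : config M :=
  iter t (step (word p)) (init M).

(* On input p, the machine writes in the long run exactly the word of q. *)
Definition computes (M : machine) (p q : baire) : Prop :=
  forall n, exists t, prefix (word_prefix q n) (output (run M p t)).

Definition computable (F : pfun baire baire) : Prop :=
  exists M : machine, forall p q, F p q -> computes M p q.

Record represented_space := RepresentedSpace {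
  carrier :> Type;
  rep : pfun baire carrier;
  rep_surj : forall x, exists p, rep p x }.

(* Partial multi-valued functions; the domain consists of the points with
   non-empty image. *)
Definition mfun (X Y : Type) := X -> set Y.

Definition mdom (X Y : Type) (f : mfun X Y) : set X := [set x | f x !=set0].

Definition realizer_wrt (X Y : Type) (dX : pfun baire X) (dY : pfun baire Y)
    (F : pfun baire baire) (f : mfun X Y) : Prop :=
  forall p x, dX p x -> mdom f x ->
    exists2 q, F p q & exists2 y, dY q y & f x y.

Definition computable_wrt (X Y : Type) (dX : pfun baire X) (dY : pfun baire Y)
    (f : mfun X Y) : Prop :=
  exists2 F, computable F & realizer_wrt dX dY F f.

Definition realizer (X Y : represented_space) (F : pfun baire baire)
    (f : mfun X Y) : Prop :=
  realizer_wrt (rep X) (rep Y) F f.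

(* p |-> K<p, G(H(p))> *)
Lemma weihrauch_comp_subproof (K G H : pfun baire baire) (p : baire) :
  is_subset1 [set s | exists2 r, pcomp G H p r & K (pairing p r) s].
Proof.
move=> s s' [r GHr Ks] [r' GHr' Ks'].
by rewrite (graph_fun GHr' GHr) in Ks'; exact: graph_fun Ks Ks'.
Qed.

Definition weihrauch_comp (K G H : pfun baire baire) : pfun baire baire :=
  PFun (@weihrauch_comp_subproof K G H).

Definition weihrauch_le (X Y Z W : represented_space)
    (f : mfun X Y) (g : mfun Z W) : Prop :=
  exists K H : pfun baire baire,
    [/\ computable K, computable H &
        forall G, realizer G g -> realizer (weihrauch_comp K G H) f].

Lemma rep_nat_subproof (p : baire) : is_subset1 [set n | p 0 = n].
Proof. by move=> m n /= <- <-. Qed.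

Definition rep_nat : pfun baire nat := PFun rep_nat_subproof.

Lemma rep_nat_surj n : exists p, rep_nat p n.
Proof. by exists (fun=> n). Qed.

Definition nat_space : represented_space := RepresentedSpace rep_nat_surj.

Lemma rep_closed_subproof (p : baire) :
  is_subset1 [set A : set nat | A = [set n | ~ range p n.+1]].
Proof. by move=> A B /= -> ->. Qed.

Definition rep_closed : pfun baire (set nat) := PFun rep_closed_subproof.

Lemma rep_closed_surj A : exists p, rep_closed p A.
Proof.
exists (fun n => if n \in A then 0 else n.+1).
apply/seteqP; split => n /=.
  by move=> An [k _]; case: ifPn => // /negP kA [kn]; apply: kA; rewrite inE kn.
by apply: contra_notP => nA; exists n => //; rewrite memNset.
Qed.

(* The space A_-(N). *)
Definition closed_nat_space : represented_space :=
  RepresentedSpace rep_closed_surj.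

Definition closed_choice_nat : mfun closed_nat_space nat_space := fun A => A.

Lemma rep_seq_subproof (X : represented_space) (p : baire) :
  is_subset1 [set x : nat -> X | forall i, rep X (component p i) (x i)].
Proof.
by move=> x y px py; apply/funext => i; exact: graph_fun (px i) (py i).
Qed.

Definition rep_seq (X : represented_space) : pfun baire (nat -> X) :=
  PFun (@rep_seq_subproof X).

Lemma rep_seq_surj (X : represented_space) (x : nat -> X) :
  exists p, rep_seq X p x.
Proof.
have [ps psx] := choice (fun i => rep_surj (x i)).
by exists (tupling ps) => i; rewrite tuplingK.
Qed.

Definition seq_space (X : represented_space) : represented_space :=
  RepresentedSpace (@rep_seq_surj X).

Definition parallelization (X Y : represented_space) (f : mfun X Y) :
    mfun (seq_space X) (seq_space Y) :=
  fun x => [set y | forall i, f (x i) (y i)].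

Lemma lim_baire_subproof (p : baire) :
  is_subset1 [set q : baire | component p @ \oo --> q].
Proof. exact: (@cvg_unique baire baire_hausdorff). Qed.

Definition lim_baire : pfun baire baire := PFun lim_baire_subproof.

(* The representation delta' = delta o lim. *)
Definition jump (X : Type) (d : pfun baire X) : pfun baire X :=
  pcomp d lim_baire.

Definition limit_computable (X Y : represented_space) (f : mfun X Y) : Prop :=
  computable_wrt (rep X) (jump (rep Y)) f.

(* Main.v *)
From Stdlib Require Cantor.
From mathcomp Require Import all_boot zify.
From mathcomp Require Import all_classical topology.
Require Import Defs.

Set Implicit Arguments.
Unset Strict Implicit.
Unset Printing Implicit Defensive.

(** A limit computation is turned into choices by asking, for every
    coordinate j, for a stage after which it has settled. Let q = <q_0, q_1,
    ...> converge to l, and let A_j consist of the codes of the pairs (k, v)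
    such that q_i(j) = v for all i >= k. Convergence says that A_j is
    inhabited, any element of A_j has second component l(j), and the
    complement of A_j can be enumerated from q: remove (k, v) as soon as
    some i >= k with q_i(j) <> v is found ([limit_computable_weihrauch]).

    Conversely, let K and H reduce f to parallelized choice. One realizer of
    choice takes the least element of each set, and the least element is the
    limit of the least numbers that have not been removed so far. So, with
    p_n the part of p read up to stage n, padded by zeros, and g_n the
    choice guessed from what H has then enumerated, run K for n steps on
    <p_n, g_n>. A finite run of K depends on finitely many entries of its
    input, so the entries that K writes on the correct input are
    eventually the ones obtained at every stage: the padded outputs form a
    computable sequence converging to the answer ([stages_lim],
    [weihrauch_limit_computable]).

    Both directions need machines that simulate arbitrary given machines.
    These are not written down as transition tables. Counter programs are
    compiled to Turing machines whose head positions are the counters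
    ([compile_correct]); primitive recursive functions are run by counter
    programs ([primrec_program]); functions between pairs, sequences, finite
    types and the like are [effective] when they are primitive recursive on
    codes, and so is the step function of any machine, acting on zipper
    tapes ([eff_output_on]). Finally, an effective function that looks at
    the input bits read so far and either emits the next output entry or
    waits is carried out by a machine ([transducer]). *)

(** * Counter machines as Turing machines *)

Inductive instr :=
| IInc of nat
| IDec of nat
| IJz of nat & nat
| IGoto of nat
| IRead of nat
| IEmit of bool.

Definition instr_reg (x : instr) : nat :=
  match x with
  | IInc r | IDec r | IJz r _ | IRead r => r
  | IGoto _ | IEmit _ => 0
  end.

Record memory := Memory { regs : nat -> nat; pos : nat; out : seq bool }.

Definition upd (f : nat -> nat) (r v : nat) : nat -> nat :=
  fun s => if s == r then v else f s.

Section CounterMachine.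
Variable code : seq instr.

Definition nregs : nat := (foldr maxn 0 (map instr_reg code)).+1.

Lemma instr_reg_bound a x : onth code a = Some x -> instr_reg x < nregs.
Proof.
rewrite /nregs ltnS; elim: code a => [|y l IHl] [|a] //= => [[->]|/IHl Hx].
  by rewrite leq_maxl.
by rewrite leq_max Hx orbT.
Qed.

(** The value of counter r is the position of head r. Zero is recognized by a
    mark on cell 0, which the initial state [None] writes on every tape; all
    other cells stay blank. *)
Definition counter_transition (s : option 'I_(size code).+1) (b : bool)
    (c : {ffun 'I_nregs -> bool}) :
    action (option 'I_(size code).+1) bool nregs :=
  let goto t := Some (inord t) in
  let act t adv m e := Action (goto t) adv c m e in
  match s with
  | None => Action (goto 0) false (fun=> true) (fun=> Stay) None
  | Some a =>
    match onth code a with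
    | None => act a false (fun=> Stay) None
    | Some (IInc r) =>
        act a.+1 false (fun i => if i == r :> nat then MoveRight else Stay) None
    | Some (IDec r) =>
        act a.+1 false (fun i => if i == r :> nat then MoveLeft else Stay) None
    | Some (IJz r t) =>
        act (if c (inord r) then t else a.+1) false (fun=> Stay) None
    | Some (IGoto t) => act t false (fun=> Stay) None
    | Some (IRead r) =>
        act a.+1 true
          (fun i => if b && (i == r :> nat) then MoveRight else Stay) None
    | Some (IEmit e) => act a.+1 false (fun=> Stay) (Some e)
    end
  end.

Definition counter_machine : machine :=
  @Machine (option 'I_(size code).+1) bool nregs None false counter_transition.

(** The tapes keep no information besides the marks on the cells 0. *)
Definition mem_config (a : nat) (m : memory) : config counter_machine :=
  @Config counter_machine (Some (inord a)) (pos m) (fun _ n => n == 0)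
    (fun i => regs m i) (out m).

Variable inp : nat -> bool.

Definition reaches a m a' m' : Prop :=
  exists t, iter t (step inp) (mem_config a m) = mem_config a' m'.

Lemma reaches_refl a m : reaches a m a m.
Proof. by exists 0. Qed.

Lemma reaches_trans a m a' m' a'' m'' :
  reaches a m a' m' -> reaches a' m' a'' m'' -> reaches a m a'' m''.
Proof. by move=> [t Et] [t' Et']; exists (t' + t); rewrite iterD Et. Qed.

Definition jump_target (x : instr) a m :=
  match x with
  | IJz r t => if regs m r == 0 then t else a.+1
  | IGoto t => t
  | _ => a.+1
  end.

Definition instr_effect (x : instr) m :=
  let: Memory f k o := m in
  match x with
  | IInc r => Memory (upd f r (f r).+1) k o
  | IDec r => Memory (upd f r (f r).-1) k o
  | IRead r => Memory (upd f r (inp k + f r)) k.+1 o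
  | IEmit e => Memory f k (rcons o e)
  | _ => m
  end.

Lemma reaches_instr a x m : onth code a = Some x ->
  reaches a m (jump_target x a m) (instr_effect x m).
Proof.
move=> ax; exists 1 => /=; rewrite /step /=.
have a_lt : a < size code by rewrite -onthTE ax.
rewrite inordK 1?ltnW ?ltnS //  ax.
have keep (c : nat -> bool) (h : nat) :
    (fun n => if n == h then (h == 0) else n == 0) = (fun n => n == 0).
  by apply/funext => n; case: eqP => // ->.
case: m => f k o.
case: x ax => [r|r|r t|t|r|e] ax; rewrite /mem_config /=; congr Config.
all: try by apply/funext => i; rewrite ffunE keep.
all: try by rewrite ?cats1 ?cats0.
- by apply/funext => i; rewrite /upd; case: eqP => // ->.
- by apply/funext => i; rewrite /upd; case: eqP => // ->.
- rewrite ffunE inordK //; exact: instr_reg_bound ax.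
- apply/funext => i; rewrite /upd; case: eqP => [->|_]; first by case: (inp k).
  by rewrite andbF.
Qed.

End CounterMachine.

(** * Structured counter programs *)

Inductive prog :=
| Inc of nat
| Dec of nat
| Read of nat
| Emit of bool
| Skip
| Then of prog & prog
| If of nat & prog & prog
| While of nat & prog.

Notation "P ;; Q" := (Then P Q) (at level 60, right associativity).

Fixpoint prog_size (P : prog) : nat :=
  match P with
  | Skip => 0
  | Then P Q => prog_size P + prog_size Q
  | If _ P Q => (prog_size P + (prog_size Q).+1).+1
  | While _ P => (prog_size P).+2
  | _ => 1
  end.

Fixpoint compile (a : nat) (P : prog) : seq instr :=
  match P with
  | Inc r => [:: IInc r]
  | Dec r => [:: IDec r]
  | Read r => [:: IRead r]
  | Emit e => [:: IEmit e]
  | Skip => [::]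
  | Then P Q => compile a P ++ compile (a + prog_size P) Q
  | If r P Q =>
      let b := a.+1 + prog_size P in
      IJz r b.+1 :: compile a.+1 P ++
        IGoto (b.+1 + prog_size Q) :: compile b.+1 Q
  | While r P =>
      let b := a.+1 + prog_size P in
      IJz r b.+1 :: compile a.+1 P ++ [:: IGoto a]
  end.

Lemma size_compile a P : size (compile a P) = prog_size P.
Proof.
elim: P a => //= [P IHP Q IHQ|r P IHP Q IHQ|r P IHP] a.
- by rewrite size_cat IHP IHQ.
- by rewrite size_cat /= IHP IHQ.
- by rewrite size_cat IHP addn1.
Qed.

(** The jump targets produced by [compile] are absolute, so correctness is
    stated relative to the place of a block in the whole code. *)
Definition located (code : seq instr) (a : nat) (c : seq instr) : Prop :=
  forall i x, onth c i = Some x -> onth code (a + i) = Some x.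

Lemma located_cons code a x c : located code a (x :: c) ->
  onth code a = Some x /\ located code a.+1 c.
Proof.
move=> H; split; first by rewrite -[a]addn0; exact: H.
by move=> i y Hy; rewrite addSnnS; exact: H.
Qed.

Lemma located_cat code a c d : located code a (c ++ d) ->
  located code a c /\ located code (a + size c) d.
Proof.
move=> H; split=> i x Hx.
  apply: H; rewrite onth_cat; move: Hx.
  by case: ltnP => // Hi; rewrite onth_default.
by rewrite -addnA; apply: H; rewrite onth_cat ltnNge leq_addr /= addKn.
Qed.

Lemma located_prefix (c d : seq instr) : located (c ++ d) 0 c.
Proof.
move=> i x ix; rewrite add0n onth_cat; move: ix.
by case: ltnP => // ?; rewrite onth_default.
Qed.

Lemma onth_size_cat (c : seq instr) x d : onth (c ++ x :: d) (size c) = Some x.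
Proof. by rewrite onth_cat ltnn subnn. Qed.

Section Exec.
Variable inp : nat -> bool.

Inductive exec : prog -> memory -> memory -> Prop :=
| EInc r f k o : exec (Inc r) (Memory f k o) (Memory (upd f r (f r).+1) k o)
| EDec r f k o : exec (Dec r) (Memory f k o) (Memory (upd f r (f r).-1) k o)
| ERead r f k o :
    exec (Read r) (Memory f k o) (Memory (upd f r (inp k + f r)) k.+1 o)
| EEmit e f k o : exec (Emit e) (Memory f k o) (Memory f k (rcons o e))
| ESkip m : exec Skip m m
| EThen P Q m1 m2 m3 : exec P m1 m2 -> exec Q m2 m3 -> exec (Then P Q) m1 m3
| EIf r P Q m m' : exec (if regs m r == 0 then Q else P) m m' ->
    exec (If r P Q) m m'
| EWhile0 r P m : regs m r = 0 -> exec (While r P) m m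
| EWhileS r P m1 m2 m3 : regs m1 r != 0 -> exec P m1 m2 ->
    exec (While r P) m2 m3 -> exec (While r P) m1 m3.

(** Induction on the execution: each construct runs its own jumps and then, by
    induction, the blocks located inside it. *)
Lemma compile_correct code P m m' : exec P m m' ->
  forall a, located code a (compile a P) ->
  reaches code inp a m (a + prog_size P) m'.
Proof.
elim=> {P m m'}.
- move=> r f k o a /located_cons[/reaches_instr H _]; rewrite addn1; exact: H.
- move=> r f k o a /located_cons[/reaches_instr H _]; rewrite addn1; exact: H.
- move=> r f k o a /located_cons[/reaches_instr H _]; rewrite addn1; exact: H.
- move=> e f k o a /located_cons[/reaches_instr H _]; rewrite addn1; exact: H.
- by move=> m a _; rewrite addn0; exact: reaches_refl.
- move=> P Q m1 m2 m3 _ IHP _ IHQ a /= /located_cat[HP].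
  rewrite size_compile => HQ; rewrite addnA.
  exact: reaches_trans (IHP _ HP) (IHQ _ HQ).
- move=> r P Q [f k o] m' _ IH a /= /located_cons[Hjz /located_cat[HP]].
  rewrite size_compile => /located_cons[Hgoto HQ].
  have := reaches_instr inp (Memory f k o) Hjz.
  rewrite /=; move: IH; rewrite /=; case: eqP => _ IH jz.
    have := reaches_trans jz (IH _ HQ).
    by congr reaches; lia.
  apply: reaches_trans jz _; apply: reaches_trans (IH _ HP) _.
  have := reaches_instr inp m' Hgoto.
  case: m' {IH} => f' k' o' /=; congr reaches; lia.
- move=> r P [f k o] /= Er a /located_cons[Hjz _].
  have := reaches_instr inp (Memory f k o) Hjz.
  by rewrite /= Er eqxx; congr reaches; lia.
- move=> r P m1 m2 m3 nz _ IHP _ IHW a HW.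
  have /= /located_cons[Hjz /located_cat[HP]] := HW.
  rewrite size_compile => /located_cons[Hgoto _].
  have := reaches_instr inp m1 Hjz.
  rewrite /= (negPf nz) => jz.
  have {}jz : reaches code inp a m1 a.+1 m1 by case: m1 jz {nz IHP}.
  apply: reaches_trans jz _; apply: reaches_trans (IHP _ HP) _.
  have := reaches_instr inp m2 Hgoto.
  have -> : instr_effect inp (IGoto a) m2 = m2 by case: (m2).
  move=> /= goto; apply: reaches_trans goto _; exact: IHW.
Qed.

End Exec.

(** * Primitive recursive functions on counters *)

(** The counters from b on seen as a stack with an infinite supply of zeros on
    top, the counters below b being those of f. *)
Definition put (f : nat -> nat) (b : nat) (l : seq nat) : nat -> nat :=
  fun r => if r < b then f r else nth 0 l (r - b).

(** The bottom b of the stack is a parameter, so that a program can be run on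
    top of values saved below it ([runs_above]). *)
Definition runs (P : nat -> prog) (l l' : seq nat) : Prop :=
  forall inp b f k o, exec inp (P b) (Memory (put f b l) k o)
    (Memory (put f b l') k o).

Lemma put_eq f b l l' : nth 0 l =1 nth 0 l' -> put f b l = put f b l'.
Proof. by move=> E; apply/funext => r; rewrite /put E. Qed.

Lemma put_cons f b x l : put f b (x :: l) = put (put f b [:: x]) b.+1 l.
Proof.
apply/funext => r; rewrite /put ltnS.
have [rb|br|->] := ltngtP r b; [by []| |by rewrite subnn].
by have -> : r - b = (r - b.+1).+1 by lia.
Qed.

Lemma upd_put f b l i v :
  upd (put f b l) (b + i) v = put f b (set_nth 0 l i v).
Proof.
apply/funext => r; rewrite /upd /put; case: ltnP => br.
  by case: eqP br => // ->; lia.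
rewrite nth_set_nth /=; congr (if _ then _ else _); apply/eqP/eqP; lia.
Qed.

Lemma put_nth f b l i : put f b l (b + i) = nth 0 l i.
Proof. by rewrite /put ltnNge leq_addr addKn. Qed.

Lemma runs_eq P l l' m m' : runs P l l' -> nth 0 l =1 nth 0 m ->
  nth 0 l' =1 nth 0 m' -> runs P m m'.
Proof.
move=> H E E' inp b f k o.
by rewrite -(put_eq _ _ E) -(put_eq _ _ E'); exact: H.
Qed.

Lemma runs_above P x l l' :
  runs P l l' -> runs (fun b => P b.+1) (x :: l) (x :: l').
Proof.
move=> H inp b f k o.
by rewrite (put_cons f b x l) (put_cons f b x l'); exact: H.
Qed.

Lemma runs_skip l : runs (fun=> Skip) l l.
Proof. by move=> *; exact: ESkip. Qed.

Lemma runs_then P Q l1 l2 l3 : runs P l1 l2 -> runs Q l2 l3 ->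
  runs (fun b => P b ;; Q b) l1 l3.
Proof.
by move=> HP HQ inp b f k o; exact: EThen (HP _ _ _ _ _) (HQ _ _ _ _ _).
Qed.

Lemma runs_inc i l :
  runs (fun b => Inc (b + i)) l (set_nth 0 l i (nth 0 l i).+1).
Proof. by move=> inp b f k o; rewrite -upd_put -(put_nth f b); exact: EInc. Qed.

Lemma runs_dec i l :
  runs (fun b => Dec (b + i)) l (set_nth 0 l i (nth 0 l i).-1).
Proof. by move=> inp b f k o; rewrite -upd_put -(put_nth f b); exact: EDec. Qed.

Lemma runs_if i P Q l l' :
  (nth 0 l i != 0 -> runs P l l') -> (nth 0 l i = 0 -> runs Q l l') ->
  runs (fun b => If (b + i) (P b) (Q b)) l l'.
Proof.
move=> HP HQ inp b f k o; apply: EIf => /=; rewrite put_nth.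
by case: eqVneq => [/HQ|/HP]; apply.
Qed.

Lemma runs_while0 i P l : nth 0 l i = 0 ->
  runs (fun b => While (b + i) (P b)) l l.
Proof. by move=> E inp b f k o; apply: EWhile0; rewrite /= put_nth. Qed.

Lemma runs_whileS i P l1 l2 l3 : nth 0 l1 i != 0 -> runs P l1 l2 ->
  runs (fun b => While (b + i) (P b)) l2 l3 ->
  runs (fun b => While (b + i) (P b)) l1 l3.
Proof.
move=> E HP HW inp b f k o.
by apply: (EWhileS _ (HP _ _ _ _ _) (HW _ _ _ _ _)); rewrite /= put_nth.
Qed.

Definition move1 i j b := While (b + i) (Dec (b + i) ;; Inc (b + j)).
Definition move2 i j j' b :=
  While (b + i) (Dec (b + i) ;; Inc (b + j) ;; Inc (b + j')).

Lemma runs_move1 i j l l' : i != j -> nth 0 l' i = 0 ->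
  nth 0 l' j = nth 0 l j + nth 0 l i ->
  (forall k, k != i -> k != j -> nth 0 l' k = nth 0 l k) ->
  runs (move1 i j) l l'.
Proof.
move=> ij; move En: (nth 0 l i) => n; elim: n l En => [|n IHn] l En Ei Ej Ek.
  apply: (@runs_eq _ l l) => //; first exact: runs_while0.
  move=> k; have [->|ki] := eqVneq k i; first by rewrite En Ei.
  have [->|kj] := eqVneq k j; first by rewrite Ej addn0.
  by rewrite Ek.
apply: runs_whileS; first by rewrite En.
  by apply: runs_then; [exact: runs_dec|exact: runs_inc].
have ji : (j == i) = false by rewrite eq_sym (negPf ij).
apply: IHn => [|//||k ki kj]; rewrite !nth_set_nth /= ?nth_set_nth /=.
- by rewrite (negPf ij) eqxx En.
- by rewrite eqxx ji Ej addnS.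
- by rewrite (negPf kj) (negPf ki) Ek.
Qed.

Lemma runs_move2 i j j' l l' : i != j -> i != j' -> j != j' -> nth 0 l' i = 0 ->
  nth 0 l' j = nth 0 l j + nth 0 l i ->
  nth 0 l' j' = nth 0 l j' + nth 0 l i ->
  (forall k, k != i -> k != j -> k != j' -> nth 0 l' k = nth 0 l k) ->
  runs (move2 i j j') l l'.
Proof.
move=> ij ij' jj'; move En: (nth 0 l i) => n.
elim: n l En => [|n IHn] l En Ei Ej Ej' Ek.
  apply: (@runs_eq _ l l) => //; first exact: runs_while0.
  move=> k; have [->|ki] := eqVneq k i; first by rewrite En Ei.
  have [->|kj] := eqVneq k j; first by rewrite Ej addn0.
  have [->|kj'] := eqVneq k j'; first by rewrite Ej' addn0.
  by rewrite Ek.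
apply: runs_whileS; first by rewrite En.
  apply: runs_then; first exact: runs_dec.
  by apply: runs_then; exact: runs_inc.
have ji : (j == i) = false by rewrite eq_sym (negPf ij).
have j'i : (j' == i) = false by rewrite eq_sym (negPf ij').
have j'j : (j' == j) = false by rewrite eq_sym (negPf jj').
apply: IHn => [|//|||k ki kj kj'];
  rewrite !nth_set_nth /= ?nth_set_nth /= ?nth_set_nth /=.
- by rewrite (negPf ij) (negPf ij') eqxx En.
- by rewrite (negPf jj') eqxx ji Ej addnS.
- by rewrite eqxx j'j j'i Ej' addnS.
- by rewrite (negPf kj) (negPf kj') (negPf ki) Ek.
Qed.

Definition npair (x y : nat) := Cantor.to_nat (x, y).
Definition nfst (n : nat) := (Cantor.of_nat n).1.
Definition nsnd (n : nat) := (Cantor.of_nat n).2.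

Lemma npairK1 x y : nfst (npair x y) = x.
Proof. by rewrite /nfst /npair Cantor.cancel_of_to. Qed.

Lemma npairK2 x y : nsnd (npair x y) = y.
Proof. by rewrite /nsnd /npair Cantor.cancel_of_to. Qed.

(** The pair code of x and y is y + (1 + ... + (x + y)). The second counter
    runs down from x + y, and the third one, starting from y, collects the
    sum. *)
Definition pairer b :=
  move2 0 1 2 b ;;
  While (b + 1) (move2 1 0 2 b ;; Dec (b + 0) ;; move1 0 1 b) ;;
  move1 2 0 b.

Fixpoint triangle n := if n is m.+1 then m.+1 + triangle m else 0.

Lemma npairE x y : npair x y = y + triangle (y + x).
Proof. by []. Qed.

Lemma runs_triangle s c :
  runs (fun b => While (b + 1) (move2 1 0 2 b ;; Dec (b + 0) ;; move1 0 1 b))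
    [:: 0; s; c] [:: 0; 0; c + triangle s].
Proof.
elim: s c => [|s IHs] c; first by rewrite addn0; exact: runs_while0.
apply: (@runs_whileS _ _ _ [:: 0; s; c + s.+1]) => //.
  apply: (@runs_then _ _ _ [:: s.+1; 0; c + s.+1]).
    by apply: runs_move2 => //; case=> [|[|[|k]]].
  apply: (runs_then (@runs_dec 0 _)).
  by apply: runs_move1 => //; case=> [|[|[|k]]].
by rewrite /= addnA; exact: IHs.
Qed.

Lemma runs_pairer x y : runs pairer [:: y; x] [:: npair x y].
Proof.
apply: (@runs_then _ _ _ [:: 0; y + x; y]).
  apply: runs_move2 => //=; first lia.
  by case=> [|[|[|k]]] //= _ _ _; rewrite !nth_nil.
apply: runs_then; first exact: runs_triangle.
apply: runs_move1 => //=.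
by case=> [|[|[|k]]] //= _ _; rewrite !nth_nil.
Qed.

(** The inverse of the pairing function enumerates the diagonals: from (x + 1,
    y) go to (x, y + 1), from (0, y) to (y + 1, 0). Counter b holds the second
    component and counter b + 1 the first. *)
Definition unpair_loop b :=
  While (b + 2)
    (Dec (b + 2) ;;
     If (b + 1) (Dec (b + 1) ;; Inc (b + 0)) (move1 0 1 b ;; Inc (b + 1))).

Definition unpairer b := move1 0 2 b ;; unpair_loop b.

Lemma runs_unpair_loop n m :
  runs unpair_loop [:: nsnd m; nfst m; n] [:: nsnd (n + m); nfst (n + m); 0].
Proof.
elim: n m => [|n IHn] m; first exact: runs_while0.
apply: (@runs_whileS _ _ _ [:: nsnd m.+1; nfst m.+1; n]) => //; last first.
  by rewrite addSnnS; exact: IHn.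
apply: (runs_then (@runs_dec 2 _)) => /=.
rewrite /nsnd /nfst /=; case: (Cantor.of_nat m) => [[|x] y] /=.
  apply: runs_if => // _.
  apply: (@runs_then _ _ _ [:: 0; y; n]); last exact: (@runs_inc 1).
  by apply: runs_move1 => //; case=> [|[|[|k]]].
apply: runs_if => // _; apply: (runs_then (@runs_dec 1 _)).
exact: (@runs_inc 0).
Qed.

Lemma runs_unpairer n : runs unpairer [:: n] [:: nsnd n; nfst n].
Proof.
apply: (@runs_then _ _ _ [:: nsnd 0; nfst 0; n]).
  by apply: runs_move1 => //; case=> [|[|[|k]]] //= _ _; rewrite !nth_nil.
apply: (runs_eq (runs_unpair_loop n 0)) => //; rewrite addn0.
by case=> [|[|[|k]]] //=; rewrite ?nth_nil.
Qed.

(** Pairing of numbers replaces functions of several arguments, and iteration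
    of the state replaces primitive recursion. *)
Inductive primrec : (nat -> nat) -> Prop :=
| primrec_id : primrec id
| primrec_zero : primrec (fun=> 0)
| primrec_succ : primrec S
| primrec_fst : primrec nfst
| primrec_snd : primrec nsnd
| primrec_pair f g : primrec f -> primrec g ->
    primrec (fun x => npair (f x) (g x))
| primrec_comp f g : primrec f -> primrec g -> primrec (fun x => g (f x))
| primrec_iter f : primrec f ->
    primrec (fun x => iter (nsnd x) f (nfst x)).

Definition clear i b := While (b + i) (Dec (b + i)).

Lemma runs_clear i l : runs (clear i) l (set_nth 0 l i 0).
Proof.
move En: (nth 0 l i) => n; elim: n l En => [|n IHn] l En.
  apply: (runs_eq (runs_while0 _ En)) => // k.
  by rewrite nth_set_nth /=; case: eqP => // ->.
apply: runs_whileS; [by rewrite En|exact: runs_dec|].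
have := IHn (set_nth 0 l i (nth 0 l i).-1).
rewrite nth_set_nth /= eqxx En => /(_ erefl)/runs_eq; apply=> // k.
by rewrite !nth_set_nth /= !nth_set_nth /=; case: eqP.
Qed.

(** The argument is replaced by the value in place, with only zeros above
    before and after; this is what lets programs for subterms run on top of
    saved values. *)
Lemma primrec_program f : primrec f ->
  exists P, forall x, runs P [:: x] [:: f x].
Proof.
elim=> {f}.
- by exists (fun=> Skip) => x; exact: runs_skip.
- by exists (clear 0) => x; exact: (@runs_clear 0).
- by exists (fun b => Inc (b + 0)) => x; exact: (@runs_inc 0).
- exists (fun b => unpairer b ;; clear 0 b ;; move1 1 0 b) => x.
  apply: (runs_then (runs_unpairer x)); apply: (runs_then (@runs_clear 0 _)).
  by apply: runs_move1 => //; case=> [|[|k]] //= _ _; rewrite !nth_nil.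
- exists (fun b => unpairer b ;; clear 1 b) => x.
  apply: (runs_then (runs_unpairer x)).
  apply: (runs_eq (@runs_clear 1 _)) => //=.
  by case=> [|[|k]] //=; rewrite nth_nil.
- move=> f g _ [P HP] _ [Q HQ].
  (* g is computed first, on top of a saved copy of x, since pairer expects the
     second component at the bottom *)
  exists (fun b =>
    move2 0 1 2 b ;; Q b.+2 ;; move1 2 0 b ;; P b.+1 ;; pairer b) => x.
  apply: (@runs_then _ _ _ [:: 0; x; x]).
    by apply: runs_move2 => //; case=> [|[|[|k]]] //= _ _; rewrite !nth_nil.
  apply: (runs_then (runs_above 0 (runs_above x (HQ x)))).
  apply: (@runs_then _ _ _ [:: g x; x]).
    by apply: runs_move1 => //; case=> [|[|[|k]]] //= _ _; rewrite !nth_nil.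
  apply: (runs_then (runs_above (g x) (HP x))).
  exact: runs_pairer.
- move=> f g _ [P HP] _ [Q HQ].
  by exists (fun b => P b ;; Q b) => x; exact: runs_then (HP _) (HQ _).
- move=> f _ [P HP].
  exists (fun b => unpairer b ;; While (b + 0) (Dec (b + 0) ;; P b.+1) ;;
    move1 1 0 b) => x.
  apply: (runs_then (runs_unpairer x)).
  apply: (@runs_then _ _ _ [:: 0; iter (nsnd x) f (nfst x)]); last first.
    by apply: runs_move1 => //; case=> [|[|k]] //= _ _; rewrite !nth_nil.
  elim: (nsnd x) (nfst x) => [|n IHn] y; first exact: runs_while0.
  rewrite iterSr; apply: (@runs_whileS 0 _ _ [:: n; f y]) (IHn (f y)) => //.
  exact: (runs_then (@runs_dec 0 [:: n.+1; y]) (runs_above n (HP y))).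
Qed.

(** * Effective functions between coded types *)

Lemma npair_ge_fst x y : x <= npair x y.
Proof.
rewrite npairE; have : y + x <= triangle (y + x) by case: (y + x) => //= n; lia.
lia.
Qed.

Lemma npair_ge_snd x y : y <= npair x y.
Proof. by rewrite npairE leq_addr. Qed.

Lemma primrec_const n : primrec (fun=> n).
Proof.
elim: n => [|n IHn]; first exact: primrec_zero.
exact: primrec_comp IHn primrec_succ.
Qed.

Lemma primrec_for n f g : primrec n -> primrec f -> primrec g ->
  primrec (fun x => iter (n x) g (f x)).
Proof.
move=> Hn Hf Hg.
have := primrec_comp (primrec_pair Hf Hn) (primrec_iter Hg).
by congr primrec; apply/funext => x; rewrite npairK1 npairK2.
Qed.

(** Iterating the map (u, v) |-> (v, v) from the pair of both values selects
    the first component for no iterations and the second one otherwise. *)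
Lemma primrec_if0 f g h : primrec f -> primrec g -> primrec h ->
  primrec (fun x => if f x == 0 then g x else h x).
Proof.
move=> Hf Hg Hh.
have Hs := primrec_pair primrec_snd primrec_snd.
have := primrec_comp (primrec_for Hf (primrec_pair Hg Hh) Hs) primrec_fst.
congr primrec; apply/funext => x; case: (f x) => [|n] /=.
  by rewrite npairK1.
rewrite npairK1; elim: n => [|n IHn]; first by rewrite npairK2.
by rewrite iterS npairK2.
Qed.

(** Iterate (u, v) |-> (v, v + 1) from (0, 0). *)
Lemma primrec_pred : primrec predn.
Proof.
have Hs := primrec_pair primrec_snd (primrec_comp primrec_snd primrec_succ).
have := primrec_comp
  (primrec_for primrec_id (primrec_const (npair 0 0)) Hs) primrec_fst.
congr primrec; apply/funext => n /=.
set s := fun x => _; suff -> : iter n s (npair 0 0) = npair n.-1 n.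
  by rewrite npairK1.
by elim: n => //= n ->; rewrite /s npairK2.
Qed.

Class coding (T : Type) := code : T -> nat.

#[export] Instance coding_nat : coding nat := id.
#[export] Instance coding_bool : coding bool := nat_of_bool.
#[export] Instance coding_prod A B (_ : coding A) (_ : coding B) :
  coding (A * B) := fun x => npair (code x.1) (code x.2).
#[export] Instance coding_option A (_ : coding A) : coding (option A) :=
  fun x => if x is Some a then (code a).+1 else 0.
#[export] Instance coding_seq A (_ : coding A) : coding (seq A) :=
  foldr (fun a n => (npair (code a) n).+1) 0.
#[export] Instance coding_fun (I : finType) A (_ : coding A) :
  coding (I -> A) :=
  fun f => foldr (fun i n => npair (code (f i)) n) 0 (enum I).
#[export] Instance coding_fin (F : finType) : coding F | 100 :=
  fun x => enum_rank x.

Definition effective A B {_ : coding A} {_ : coding B} (f : A -> B) : Prop :=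
  exists2 h, primrec h & forall a, h (code a) = code (f a).

Section Effective.
Context {C : Type} {cC : coding C}.

Lemma eff_ext A {_ : coding A} (f g : C -> A) :
  effective f -> f =1 g -> effective g.
Proof. by move=> Hf /funext <-. Qed.

Lemma eff_id : effective (fun c : C => c).
Proof. by exists id => //; exact: primrec_id. Qed.

Lemma eff_const A {_ : coding A} (a : A) : effective (fun _ : C => a).
Proof. by exists (fun=> code a) => //; exact: primrec_const. Qed.

Lemma eff_comp A B {_ : coding A} {_ : coding B} (f : C -> A) (g : A -> B) :
  effective f -> effective g -> effective (fun c => g (f c)).
Proof.
move=> [h Hh hf] [k Hk kg]; exists (fun x => k (h x)).
  exact: primrec_comp.
by move=> c; rewrite hf kg.
Qed.

Lemma eff_pair A B {_ : coding A} {_ : coding B} (f : C -> A) (g : C -> B) :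
  effective f -> effective g -> effective (fun c => (f c, g c)).
Proof.
move=> [h Hh hf] [k Hk kg].
exists (fun x => npair (h x) (k x)) => [|c]; first exact: primrec_pair.
by rewrite /= hf kg.
Qed.

Lemma eff_fst A B {_ : coding A} {_ : coding B} (f : C -> A * B) :
  effective f -> effective (fun c => (f c).1).
Proof.
move=> [h Hh hf]; exists (fun x => nfst (h x)).
  exact: primrec_comp Hh primrec_fst.
by move=> c; rewrite hf npairK1.
Qed.

Lemma eff_snd A B {_ : coding A} {_ : coding B} (f : C -> A * B) :
  effective f -> effective (fun c => (f c).2).
Proof.
move=> [h Hh hf]; exists (fun x => nsnd (h x)).
  exact: primrec_comp Hh primrec_snd.
by move=> c; rewrite hf npairK2.
Qed.

Lemma eff_nfst (n : C -> nat) : effective n -> effective (fun c => nfst (n c)).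
Proof.
move=> [h Hh hn]; exists (fun x => nfst (h x)) => [|c]; last by rewrite hn.
exact: primrec_comp Hh primrec_fst.
Qed.

Lemma eff_nsnd (n : C -> nat) : effective n -> effective (fun c => nsnd (n c)).
Proof.
move=> [h Hh hn]; exists (fun x => nsnd (h x)) => [|c]; last by rewrite hn.
exact: primrec_comp Hh primrec_snd.
Qed.

Lemma eff_npair (m n : C -> nat) :
  effective m -> effective n -> effective (fun c => npair (m c) (n c)).
Proof. by move=> Hm Hn; have [h Hh hE] := eff_pair Hm Hn; exists h. Qed.

(** The parameter c is carried along in the first component of the iterated
    state. *)
Lemma eff_iter A {_ : coding A} (n : C -> nat) (a : C -> A) (g : C * A -> A) :
  effective n -> effective a -> effective g ->
  effective (fun c => iter (n c) (fun x => g (c, x)) (a c)).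
Proof.
move=> [h Hh hn] [k Hk ka] [l Hl lg].
pose st y := npair (nfst y) (l y).
exists (fun x => nsnd (iter (h x) st (npair x (k x)))).
  apply: primrec_comp primrec_snd.
  apply: primrec_for Hh (primrec_pair primrec_id Hk) _.
  exact: primrec_pair primrec_fst Hl.
move=> c; rewrite hn ka; set F := iter _ _ _.
have -> : F = npair (code c) (code (iter (n c) (fun x => g (c, x)) (a c))).
  rewrite /F [code (n c)]/code /coding_nat; elim: (n c) => //= m ->.
  by rewrite /st npairK1; congr npair; exact: (lg (c, _)).
exact: npairK2.
Qed.

Lemma eff_succ (n : C -> nat) : effective n -> effective (fun c => (n c).+1).
Proof.
move=> [h Hh hn]; exists (fun x => (h x).+1) => [|c]; last by rewrite hn.
exact: primrec_comp Hh primrec_succ.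
Qed.

Lemma eff_pred (n : C -> nat) : effective n -> effective (fun c => (n c).-1).
Proof.
move=> [h Hh hn]; exists (fun x => (h x).-1) => [|c]; last by rewrite hn.
exact: primrec_comp Hh primrec_pred.
Qed.

Lemma eff_if A {_ : coding A} (b : C -> bool) (f g : C -> A) :
  effective b -> effective f -> effective g ->
  effective (fun c => if b c then f c else g c).
Proof.
move=> [h Hh hb] [k Hk kf] [l Hl lg].
exists (fun x => if h x == 0 then l x else k x); first exact: primrec_if0.
by move=> c; rewrite hb kf lg; case: (b c).
Qed.

Lemma eff_match_seq A B {_ : coding A} {_ : coding B} (s : C -> seq A)
    (f : C -> B) (g : C * (A * seq A) -> B) :
  effective s -> effective f -> effective g ->
  effective (fun c => if s c is a :: s' then g (c, (a, s')) else f c).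
Proof.
move=> [h Hh hs] [k Hk kf] [l Hl lg].
exists (fun x => if h x == 0 then k x else l (npair x (h x).-1)).
  apply: primrec_if0 => //; apply: primrec_comp Hl.
  exact: primrec_pair primrec_id (primrec_comp Hh primrec_pred).
by move=> c; rewrite hs; case: (s c) => [|a s'] //=; rewrite -lg.
Qed.

Lemma eff_match_option A B {_ : coding A} {_ : coding B} (s : C -> option A)
    (f : C -> B) (g : C * A -> B) :
  effective s -> effective f -> effective g ->
  effective (fun c => if s c is Some a then g (c, a) else f c).
Proof.
move=> [h Hh hs] [k Hk kf] [l Hl lg].
exists (fun x => if h x == 0 then k x else l (npair x (h x).-1)).
  apply: primrec_if0 => //; apply: primrec_comp Hl.
  exact: primrec_pair primrec_id (primrec_comp Hh primrec_pred).
by move=> c; rewrite hs; case: (s c) => [a|] //=; rewrite -lg.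
Qed.

Lemma eff_some A {_ : coding A} (f : C -> A) :
  effective f -> effective (fun c => Some (f c)).
Proof.
move=> [h Hh hf]; exists (fun x => (h x).+1) => [|c]; last by rewrite hf.
exact: primrec_comp Hh primrec_succ.
Qed.

Lemma eff_cons A {_ : coding A} (f : C -> A) (s : C -> seq A) :
  effective f -> effective s -> effective (fun c => f c :: s c).
Proof.
move=> [h Hh hf] [k Hk ks]; exists (fun x => (npair (h x) (k x)).+1).
  exact: primrec_comp (primrec_pair Hh Hk) primrec_succ.
by move=> c; rewrite hf ks.
Qed.

(** A finite case distinction, in which F is observed through equality
    tests. *)
Lemma eff_finmatch (F : finType) B {_ : coding B} (f : C -> F)
    (g : F -> C -> B) :
  (forall x, effective (fun c => f c == x)) -> (forall x, effective (g x)) ->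
  effective (fun c => g (f c) c).
Proof.
move=> Hf Hg.
have [h Hh hg] : exists2 h, primrec h &
    forall c, f c \in enum F -> h (code c) = code (g (f c) c); last first.
  by exists h => // c; rewrite hg // mem_enum.
elim: (enum F) => [|x l [h Hh IH]].
  by exists (fun=> 0) => //; exact: primrec_zero.
have [k Hk kf] := Hf x; have [m Hm mg] := Hg x.
exists (fun y => if k y == 0 then h y else m y); first exact: primrec_if0.
move=> c; rewrite inE kf mg; case: eqVneq => [-> //|_] /=; exact: IH.
Qed.

Lemma eff_fun (I : finType) A {_ : coding A} (f : C -> I -> A) :
  (forall i, effective (fun c => f c i)) -> effective f.
Proof.
move=> Hf.
have [h Hh hf] : exists2 h, primrec h & forall c, h (code c) =
    foldr (fun i n => npair (code (f c i)) n) 0 (enum I); last by exists h.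
elim: (enum I) => [|i l [h Hh IH]].
  by exists (fun=> 0) => //; exact: primrec_zero.
have [k Hk kf] := Hf i; exists (fun x => npair (k x) (h x)).
  exact: primrec_pair.
by move=> c; rewrite /= IH kf.
Qed.

Lemma eff_app (I : finType) A {_ : coding A} (f : C -> I -> A) i :
  effective f -> effective (fun c => f c i).
Proof.
have Hi : effective (fun g : I -> A => g i); last first.
  by move=> Hf; exact: eff_comp Hf Hi.
have [h Hh hi] : exists2 h, primrec h & forall g : I -> A, i \in enum I ->
    h (foldr (fun i n => npair (code (g i)) n) 0 (enum I)) = code (g i);
    last first.
  by exists h => // g; apply: hi; rewrite mem_enum.
elim: (enum I) => [|j l [h Hh IH]]; first by exists id => //; exact: primrec_id.
have [->|ij] := eqVneq i j.
  by exists nfst => [|g _]; [exact: primrec_fst|rewrite /= npairK1].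
exists (fun x => h (nsnd x)); first exact: primrec_comp primrec_snd Hh.
by move=> g; rewrite inE (negPf ij) /= npairK2; exact: IH.
Qed.

End Effective.

Section Arithmetic.
Context {C : Type} {cC : coding C}.

Lemma eff_add (m n : C -> nat) :
  effective m -> effective n -> effective (fun c => m c + n c).
Proof.
move=> Hm Hn.
apply: (eff_ext (eff_iter Hm Hn (eff_succ (eff_snd eff_id)))) => c.
by rewrite iter_succn addnC.
Qed.

Lemma eff_sub (m n : C -> nat) :
  effective m -> effective n -> effective (fun c => m c - n c).
Proof.
move=> Hm Hn.
apply: (eff_ext (eff_iter Hn Hm (eff_pred (eff_snd eff_id)))) => c.
by rewrite iter_predn.
Qed.

Lemma eff_negb (a : C -> bool) :
  effective a -> effective (fun c => ~~ a c).
Proof. by move=> Ha; apply: (eff_if Ha (eff_const false) (eff_const true)). Qed.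

Lemma eff_andb (a b : C -> bool) :
  effective a -> effective b -> effective (fun c => a c && b c).
Proof. by move=> Ha Hb; apply: (eff_if Ha Hb (eff_const false)). Qed.

Lemma eff_orb (a b : C -> bool) :
  effective a -> effective b -> effective (fun c => a c || b c).
Proof. by move=> Ha Hb; apply: (eff_if Ha (eff_const true) Hb). Qed.

Lemma eff_leq (m n : C -> nat) :
  effective m -> effective n -> effective (fun c => m c <= n c).
Proof.
move=> Hm Hn.
apply: (eff_ext (eff_iter (eff_sub Hm Hn) (eff_const true)
  (eff_const false))) => c.
by rewrite -subn_eq0; case: (_ - _).
Qed.

Lemma eff_eqn (m n : C -> nat) :
  effective m -> effective n -> effective (fun c => m c == n c).
Proof.
move=> Hm Hn; apply: (eff_ext (eff_andb (eff_leq Hm Hn) (eff_leq Hn Hm))) => c.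
by rewrite eqn_leq.
Qed.

Lemma eff_eq_fin (F : finType) (f : C -> F) x :
  effective f -> effective (fun c => f c == x).
Proof.
move=> [h Hh hf].
have Hc : effective (fun c => code (f c)) by exists h.
apply: (eff_ext (eff_eqn Hc (eff_const (code x)))) => c.
by rewrite (inj_eq val_inj) (inj_eq enum_rank_inj).
Qed.

Lemma eff_eq_bool (a : C -> bool) (b : bool) :
  effective a -> effective (fun c => a c == b).
Proof.
move=> Ha; case: b; first by under eq_fun do rewrite eqb_id.
by under eq_fun do rewrite eqbF_neg; exact: eff_negb.
Qed.

Lemma eff_all (I : Type) (l : seq I) (b : I -> C -> bool) :
  (forall i, effective (b i)) -> effective (fun c => all (fun i => b i c) l).
Proof.
move=> Hb; elim: l => [|i l IHl] /=; first exact: eff_const.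
exact: eff_andb.
Qed.

End Arithmetic.

Lemma eff_behead C A {_ : coding C} {_ : coding A} (s : C -> seq A) :
  effective s -> effective (fun c => behead (s c)).
Proof.
move=> Hs; apply: (eff_ext (eff_match_seq Hs (eff_const [::])
  (eff_snd (eff_snd eff_id)))) => c.
by case: (s c).
Qed.

Lemma eff_head C A {_ : coding C} {_ : coding A} (x : A) (s : C -> seq A) :
  effective s -> effective (fun c => seq.head x (s c)).
Proof.
move=> Hs; apply: (eff_ext (eff_match_seq Hs (eff_const x)
  (eff_fst (eff_snd eff_id)))) => c.
by case: (s c).
Qed.

(** The head of the sequence is consumed at each iteration. The code of the
    sequence is at least its length, and further iterations on an empty
    sequence change nothing, so it can serve as the number of iterations. *)
Lemma eff_foldl C A B {_ : coding C} {_ : coding A} {_ : coding B}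
    (s : C -> seq A) (b : C -> B)
    (g : C * (B * A) -> B) :
  effective s -> effective b -> effective g ->
  effective (fun c => foldl (fun y x => g (c, (y, x))) (b c) (s c)).
Proof.
move=> Hs Hb Hg.
have Hn : effective (fun c => code (s c)) by case: Hs => h Hh hs; exists h.
pose st (z : C * (seq A * B)) : seq A * B :=
  if z.2.1 is x :: s' then (s', g (z.1, (z.2.2, x))) else z.2.
have Hst : effective st.
  apply: (@eff_match_seq _ _ _ _ _ _ (fun z => z.2.1) (fun z => z.2)
    (fun w => (w.2.2, g (w.1.1, (w.1.2.2, w.2.1))))).
  - exact: eff_fst (eff_snd eff_id).
  - exact: eff_snd eff_id.
  apply: eff_pair; first exact: eff_snd (eff_snd eff_id).
  apply: eff_comp Hg; apply: eff_pair.
    exact: eff_fst (eff_fst eff_id).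
  apply: eff_pair; first exact: eff_snd (eff_snd (eff_fst eff_id)).
  exact: eff_fst (eff_snd eff_id).
apply: (eff_ext (eff_snd (eff_iter Hn (eff_pair Hs Hb) Hst))) => c.
have : size (s c) <= code (s c).
  elim: (s c) => //= x l IHl; rewrite ltnS.
  exact: leq_trans IHl (npair_ge_snd _ _).
have stN y n : iter n (fun z => st (c, z)) ([::], y) = ([::], y).
  by elim: n => //= n ->.
move: (code (s c)) => n; elim: n (s c) (b c) => [|n IHn] [|x l] y //.
  by move=> _; rewrite stN.
rewrite iterSr ltnS; exact: IHn.
Qed.

Lemma eff_rev C A {_ : coding C} {_ : coding A} (s : C -> seq A) :
  effective s -> effective (fun c => rev (s c)).
Proof.
move=> Hs; have Hg : effective (fun z : C * (seq A * A) => z.2.2 :: z.2.1).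
  exact: eff_cons (eff_snd (eff_snd eff_id)) (eff_fst (eff_snd eff_id)).
apply: (eff_ext (eff_foldl Hs (eff_const [::]) Hg)) => c /=.
by rewrite /rev; elim: (s c) [::] => //= x l IHl acc; rewrite IHl.
Qed.

Lemma eff_foldr C A B {_ : coding C} {_ : coding A} {_ : coding B}
    (s : C -> seq A) (b : C -> B)
    (g : C * (A * B) -> B) :
  effective s -> effective b -> effective g ->
  effective (fun c => foldr (fun x y => g (c, (x, y))) (b c) (s c)).
Proof.
move=> Hs Hb Hg.
have Hg' : effective (fun z : C * (B * A) => g (z.1, (z.2.2, z.2.1))).
  apply: eff_comp Hg; apply: eff_pair (eff_fst eff_id) _.
  exact: eff_pair (eff_snd (eff_snd eff_id)) (eff_fst (eff_snd eff_id)).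
by apply: (eff_ext (eff_foldl (eff_rev Hs) Hb Hg')) => c; rewrite foldl_rev.
Qed.

Lemma eff_map C A B {_ : coding C} {_ : coding A} {_ : coding B}
    (s : C -> seq A) (g : C * A -> B) :
  effective s -> effective g ->
  effective (fun c => [seq g (c, x) | x <- s c]).
Proof.
move=> Hs Hg.
have Hg' : effective (fun z : C * (A * seq B) => g (z.1, z.2.1) :: z.2.2).
  apply: eff_cons (eff_snd (eff_snd eff_id)); apply: eff_comp Hg.
  exact: eff_pair (eff_fst eff_id) (eff_fst (eff_snd eff_id)).
apply: (eff_ext (eff_foldr Hs (eff_const [::]) Hg')) => c.
by elim: (s c) => //= ? ? ->.
Qed.

Lemma eff_cat C A {_ : coding C} {_ : coding A} (s t : C -> seq A) :
  effective s -> effective t -> effective (fun c => s c ++ t c).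
Proof.
move=> Hs Ht; apply: (eff_ext (eff_foldr Hs Ht
  (eff_cons (eff_fst (eff_snd eff_id)) (eff_snd (eff_snd eff_id))))) => c.
by elim: (s c) => //= ? ? ->.
Qed.

Lemma eff_rcons C A {_ : coding C} {_ : coding A} (s : C -> seq A)
    (x : C -> A) :
  effective s -> effective x -> effective (fun c => rcons (s c) (x c)).
Proof.
move=> Hs Hx; apply: (eff_ext (eff_cat Hs (eff_cons Hx (eff_const [::])))) => c.
by rewrite cats1.
Qed.

Lemma eff_size C A {_ : coding C} {_ : coding A} (s : C -> seq A) :
  effective s -> effective (fun c => size (s c)).
Proof.
move=> Hs; apply: (eff_ext (eff_foldr Hs (eff_const 0)
  (eff_succ (eff_snd (eff_snd eff_id))))) => c.
by elim: (s c) => //= ? ? ->.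
Qed.

Lemma eff_nth C A {_ : coding C} {_ : coding A} (x : A) (s : C -> seq A)
    (n : C -> nat) :
  effective s -> effective n -> effective (fun c => nth x (s c) (n c)).
Proof.
move=> Hs Hn; apply: (eff_ext (eff_head x (eff_iter Hn Hs
  (eff_behead (eff_snd eff_id))))) => c.
elim: (n c) (s c) => [|m IHm] [|y l] //; rewrite iterSr //=.
by rewrite IHm nth_nil.
Qed.

Lemma eff_iota C {_ : coding C} (m n : C -> nat) :
  effective m -> effective n -> effective (fun c => iota (m c) (n c)).
Proof.
move=> Hm Hn.
have Hg : effective (fun z : C * (nat * seq nat) =>
    (z.2.1.-1, z.2.1.-1 :: z.2.2)).
  have H : effective (fun z : C * (nat * seq nat) => z.2.1.-1).
    exact: eff_pred (eff_fst (eff_snd eff_id)).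
  exact: eff_pair H (eff_cons H (eff_snd (eff_snd eff_id))).
apply: (eff_ext (eff_snd (eff_iter Hn
  (eff_pair (eff_add Hm Hn) (eff_const [::])) Hg))) => c.
set st := fun _ => _.
have E k l j : iter k st (j + k, l) = (j, iota j k ++ l).
  elim: k l => [|k IHk] l; first by rewrite addn0.
  have -> : iota j k.+1 = rcons (iota j k) (j + k).
    by rewrite -addn1 iotaD cats1.
  by rewrite cat_rcons -IHk iterSr /st /= addnS.
by rewrite E cats0.
Qed.

Lemma eff_flatten C A {_ : coding C} {_ : coding A} (s : C -> seq (seq A)) :
  effective s -> effective (fun c => flatten (s c)).
Proof.
move=> Hs; exact: (eff_foldr Hs (eff_const [::])
  (eff_cat (eff_fst (eff_snd eff_id)) (eff_snd (eff_snd eff_id)))).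
Qed.

Lemma eff_nseq C A {_ : coding C} {_ : coding A} (n : C -> nat) (x : C -> A) :
  effective n -> effective x -> effective (fun c => nseq (n c) (x c)).
Proof.
move=> Hn Hx; have Hg : effective (fun z : C * seq A => x z.1 :: z.2).
  exact: eff_cons (eff_comp (eff_fst eff_id) Hx) (eff_snd eff_id).
exact: (eff_ext (eff_iter Hn (eff_const [::]) Hg)).
Qed.

Lemma eff_has C A {_ : coding C} {_ : coding A} (s : C -> seq A)
    (a : C * A -> bool) :
  effective s -> effective a ->
  effective (fun c => has (fun x => a (c, x)) (s c)).
Proof.
move=> Hs Ha.
have Hg : effective (fun z : C * (A * bool) => a (z.1, z.2.1) || z.2.2).
  apply: eff_orb (eff_snd (eff_snd eff_id)); apply: eff_comp Ha.
  exact: eff_pair (eff_fst eff_id) (eff_fst (eff_snd eff_id)).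
exact: (eff_ext (eff_foldr Hs (eff_const false) Hg)).
Qed.

Lemma eff_find C A {_ : coding C} {_ : coding A} (s : C -> seq A)
    (a : C * A -> bool) :
  effective s -> effective a ->
  effective (fun c => find (fun x => a (c, x)) (s c)).
Proof.
move=> Hs Ha.
have Hg : effective (fun z : C * (A * nat) =>
    if a (z.1, z.2.1) then 0 else z.2.2.+1).
  have Ha' : effective (fun z : C * (A * nat) => a (z.1, z.2.1)).
    apply: eff_comp Ha.
    exact: eff_pair (eff_fst eff_id) (eff_fst (eff_snd eff_id)).
  exact: eff_if Ha' (eff_const 0) (eff_succ (eff_snd (eff_snd eff_id))).
apply: (eff_ext (eff_foldr Hs (eff_const 0) Hg)) => c.
by elim: (s c) => //= ? ? ->.
Qed.

Lemma eff_mkseq C A {_ : coding C} {_ : coding A} (g : C * nat -> A)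
    (n : C -> nat) :
  effective g -> effective n ->
  effective (fun c => mkseq (fun i => g (c, i)) (n c)).
Proof.
by move=> Hg Hn; apply: eff_map => //; apply: eff_iota => //; exact: eff_const.
Qed.

Lemma eff_odd C {_ : coding C} (n : C -> nat) :
  effective n -> effective (fun c => odd (n c)).
Proof.
move=> Hn; apply: (eff_ext (eff_iter Hn (eff_const false)
  (eff_negb (eff_snd eff_id)))) => c.
by elim: (n c) => //= m ->.
Qed.

(** Iterate (u, v) |-> (v, u + 1), which computes floor and ceiling
    together. *)
Lemma eff_half C {_ : coding C} (n : C -> nat) :
  effective n -> effective (fun c => (n c)./2).
Proof.
move=> Hn; have Hg : effective (fun x : C * (nat * nat) => (x.2.2, x.2.1.+1)).
  exact: eff_pair (eff_snd (eff_snd eff_id))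
    (eff_succ (eff_fst (eff_snd eff_id))).
apply: (eff_ext (eff_fst (eff_iter Hn (eff_const (0, 0)) Hg))) => c.
set st := fun _ => _; suff -> m : iter m st (0, 0) = (m./2, uphalf m) by [].
by elim: m => // m; rewrite iterS => ->.
Qed.

Lemma eff_pairing C {_ : coding C} (p q : C -> nat -> nat) (n : C -> nat) :
  effective (fun x : C * nat => p x.1 x.2) ->
  effective (fun x : C * nat => q x.1 x.2) -> effective n ->
  effective (fun c => pairing (p c) (q c) (n c)).
Proof.
move=> Hp Hq Hn; rewrite /pairing.
have Hh := eff_pair eff_id (eff_half Hn).
exact: eff_if (eff_odd Hn) (eff_comp Hh Hq) (eff_comp Hh Hp).
Qed.

Lemma eff_word_prefix C {_ : coding C} (p : C -> nat -> nat) (n : C -> nat) :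
  effective (fun x : C * nat => p x.1 x.2) -> effective n ->
  effective (fun c => word_prefix (p c) (n c)).
Proof.
move=> Hp Hn; apply: eff_flatten.
apply: (@eff_map _ _ _ _ _ _ _
  (fun x : C * nat => rcons (nseq (p x.1 x.2) true) false)).
  exact: eff_iota (eff_const 0) Hn.
exact: eff_rcons (eff_nseq Hp (eff_const true)) (eff_const false).
Qed.

(** * Simulating machines and building transducers *)

Section Simulation.
Variable M : machine.

(** Zippers: the cells left of the head in reverse order, and the cells from
    the head on without trailing blanks that were never visited. Reading,
    writing and moving then only touch the first elements. *)
Definition tape : Type := (seq (symbol M) * seq (symbol M))%type.
Definition zconfig : Type :=
  ((state M * nat) * (('I_(tapes M) -> tape) * seq bool))%type.

Definition scan (z : tape) : symbol M := seq.head (blank M) z.2.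

Definition rewrite_tape (a : symbol M) (m : move) (z : tape) : tape :=
  let r := a :: behead z.2 in
  match m with
  | MoveLeft => if z.1 is b :: l then (l, b :: r) else ([::], r)
  | Stay => (z.1, r)
  | MoveRight => (a :: z.1, behead z.2)
  end.

Definition unzip (c : zconfig) : config M :=
  Config c.1.1 c.1.2
    (fun i n => nth (blank M) (rev (c.2.1 i).1 ++ (c.2.1 i).2) n)
    (fun i => size (c.2.1 i).1) c.2.2.

(** What the transition function sees. It ranges over a finite type, so that a
    step is a finite case distinction between fixed updates. *)
Definition zview (w : seq bool) (c : zconfig) :=
  (c.1.1, nth false w c.1.2, [ffun i => scan (c.2.1 i)]).

Definition zupdate (x : state M * bool * {ffun 'I_(tapes M) -> symbol M})
    (c : zconfig) : zconfig :=
  let a := transition x.1.1 x.1.2 x.2 in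
  ((next_state a, advance_input a + c.1.2),
   (fun i => rewrite_tape (written a i) (moved a i) (c.2.1 i),
    c.2.2 ++ seq_of_opt (emitted a))).

Definition zstep w c := zupdate (zview w c) c.

Definition zinit : zconfig := ((start M, 0), (fun=> ([::], [::]), [::])).

Lemma step_unzip w c : step (nth false w) (unzip c) = unzip (zstep w c).
Proof.
case: c => [[s h] [ts o]]; rewrite /step /unzip /zstep /zview /zupdate /=.
set F := [ffun i => _]; set G := [ffun i => _].
have -> : F = G.
  apply/ffunP => i; rewrite !ffunE nth_cat size_rev ltnn subnn.
  by rewrite nth0.
set a := transition _ _ _; congr Config.
  apply/funext => i; apply/funext => n; case: (ts i) => l r /=.
  set v := written a i; transitivity (nth (blank M) (rev l ++ v :: behead r) n).
    rewrite !nth_cat size_rev.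
    case: ltngtP => // [ln|->]; last by rewrite subnn.
    case: (n - size l) (subn_gt0 (size l) n) => [|m]; first by rewrite ln.
    by rewrite /= nth_behead.
  case: (moved a i) => //=; last by rewrite rev_cons cat_rcons.
  by case: l => //= b l; rewrite rev_cons cat_rcons.
by apply/funext => i; case: (moved a i) (ts i) => [] [[|b l] r].
Qed.

Lemma iter_step_unzip w t :
  iter t (step (nth false w)) (init M) = unzip (iter t (zstep w) zinit).
Proof.
elim: t => [|t /= ->]; last exact: step_unzip.
by congr Config; apply/funext => i; apply/funext => n; rewrite /= nth_nil.
Qed.

Lemma eff_rewrite_tape C {_ : coding C} a m (z : C -> tape) :
  effective z -> effective (fun c => rewrite_tape a m (z c)).
Proof.
move=> Hz; have Hr : effective (fun c => a :: behead (z c).2).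
  exact: eff_cons (eff_const a) (eff_behead (eff_snd Hz)).
case: m; rewrite /rewrite_tape.
- apply: (@eff_match_seq _ _ _ _ _ _ (fun c => (z c).1)
    (fun c => ([::], a :: behead (z c).2))
    (fun y => (y.2.2, y.2.1 :: a :: behead (z y.1).2))).
  + exact: eff_fst.
  + exact: eff_pair (eff_const [::]) Hr.
  apply: eff_pair (eff_snd (eff_snd eff_id)) _.
  exact: eff_cons (eff_fst (eff_snd eff_id)) (eff_comp (eff_fst eff_id) Hr).
- exact: eff_pair (eff_fst Hz) Hr.
- exact: eff_pair (eff_cons (eff_const a) (eff_fst Hz))
    (eff_behead (eff_snd Hz)).
Qed.

Lemma eff_zstep : effective (fun x : seq bool * zconfig => zstep x.1 x.2).
Proof.
apply: (@eff_finmatch _ _ _ _ _ (fun x : seq bool * zconfig => zview x.1 x.2)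
  (fun v x => zupdate v x.2)) => [[[s b] g]|v].
  rewrite /zview; under eq_fun do rewrite !xpair_eqE.
  apply: eff_andb; first apply: eff_andb.
  - exact: eff_eq_fin (eff_fst (eff_fst (eff_snd eff_id))).
  - apply: eff_eq_bool; apply: eff_nth; first exact: eff_fst eff_id.
    exact: eff_snd (eff_fst (eff_snd eff_id)).
  have H : effective (fun x : seq bool * zconfig =>
      all (fun i => scan (x.2.2.1 i) == g i) (enum 'I_(tapes M))).
    apply: eff_all => i; apply: eff_eq_fin; apply: eff_head; apply: eff_snd.
    exact: eff_app (eff_fst (eff_snd (eff_snd eff_id))).
  apply: (eff_ext H) => x; apply/allP/eqP => [E|<- i _]; last by rewrite ffunE.
  by apply/ffunP => i; rewrite ffunE; apply/eqP/E; rewrite mem_enum.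
rewrite /zupdate; set a := transition _ _ _.
apply: eff_pair; apply: eff_pair.
- exact: eff_const.
- exact: eff_add (eff_const _) (eff_snd (eff_fst (eff_snd eff_id))).
- apply: eff_fun => i; apply: eff_rewrite_tape.
  exact: eff_app (eff_fst (eff_snd (eff_snd eff_id))).
- exact: eff_cat (eff_snd (eff_snd (eff_snd eff_id))) (eff_const _).
Qed.

Definition output_on (w : seq bool) (t : nat) : seq bool :=
  output (iter t (step (nth false w)) (init M)).

Lemma eff_output_on C {_ : coding C} (w : C -> seq bool) (t : C -> nat) :
  effective w -> effective t -> effective (fun c => output_on (w c) (t c)).
Proof.
move=> Hw Ht.
have Hs : effective (fun x : C * zconfig => zstep (w x.1) x.2).
  exact: eff_comp
    (eff_pair (eff_comp (eff_fst eff_id) Hw) (eff_snd eff_id)) eff_zstep.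
apply: (eff_ext (eff_snd (eff_snd (eff_iter Ht (eff_const zinit) Hs)))) => c.
by rewrite /output_on iter_step_unzip.
Qed.

Lemma input_head_iter inp t :
  input_head (iter t (step inp) (init M)) <= t.
Proof.
elim: t => //= t IHt; case: (advance_input _) => /=; last exact: leqW.
by rewrite add1n ltnS.
Qed.

(** In t steps the input head reads only cells before t. *)
Lemma eq_iter_step (inp inp' : nat -> bool) t :
  (forall m, m < t -> inp m = inp' m) ->
  iter t (step inp) (init M) = iter t (step inp') (init M).
Proof.
elim: t => //= t IHt E; rewrite -IHt => [|m mt].
  by rewrite /step E // ltnS input_head_iter.
by apply: E; rewrite ltnS ltnW.
Qed.

Lemma prefix_output_step inp (c : config M) :
  prefix (output c) (output (step inp c)).
Proof. exact: prefix_prefix. Qed.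

Lemma prefix_output_run p s t : s <= t ->
  prefix (output (run M p s)) (output (run M p t)).
Proof.
move=> /subnK <-; elim: (t - s) => [|n IHn]; first exact: prefix_refl.
exact: prefix_trans IHn (prefix_output_step _ _).
Qed.

End Simulation.

Lemma word_prefixS p n :
  word_prefix p n.+1 = word_prefix p n ++ rcons (nseq (p n) true) false.
Proof. by rewrite /word_prefix -addn1 iotaD map_cat flatten_cat /= cats0. Qed.

Lemma prefix_word_prefix p m n : m <= n ->
  prefix (word_prefix p m) (word_prefix p n).
Proof.
move=> /subnK <-; elim: (n - m) => [|k IHk]; first exact: prefix_refl.
by rewrite addSn word_prefixS; apply: prefix_trans IHk (prefix_prefix _ _).
Qed.

Lemma size_word_prefix p n : n <= size (word_prefix p n).
Proof.
elim: n => // n IHn; rewrite word_prefixS size_cat size_rcons addnS ltnS.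
exact: leq_trans IHn (leq_addr _ _).
Qed.

Lemma nth_prefix (T : eqType) (x : T) (s t : seq T) m :
  prefix s t -> m < size s -> nth x t m = nth x s m.
Proof. by move=> /prefixP[u ->] ms; rewrite nth_cat ms. Qed.

Lemma nth_word_prefix p n m : m < size (word_prefix p n) ->
  nth false (word_prefix p n) m = word p m.
Proof.
move=> mn; rewrite /word; have mm := size_word_prefix p m.+1.
have [nm|/ltnW nm] := leqP n m.+1.
  by rewrite (nth_prefix _ (prefix_word_prefix p nm)).
by rewrite (nth_prefix _ (prefix_word_prefix p nm)).
Qed.

Lemma output_run M p t : output (run M p t) = output_on M (word_prefix p t) t.
Proof.
rewrite /run /output_on.
rewrite (@eq_iter_step _ _ (nth false (word_prefix p t))) // => m mt.
by rewrite nth_word_prefix // (leq_trans mt) // size_word_prefix.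
Qed.

Lemma output_run_mkseq M p t :
  output (run M p t) = output_on M (mkseq (word p) t) t.
Proof.
rewrite /run /output_on.
rewrite (@eq_iter_step _ _ (nth false (mkseq (word p) t))) // => m mt.
by rewrite nth_mkseq.
Qed.

(** An online computation: given the bits w of the input read so far, phi
    proposes a value for entry n of the output, or asks for more input. *)
Section Transducer.
Variable phi : seq bool * nat -> option nat.
Hypothesis phi_eff : effective phi.

(** The state consists of the bits read and the number of entries written. *)
Definition transduce (x : bool * (seq bool * nat)) :
    option nat * (seq bool * nat) :=
  let w := rcons x.2.1 x.1 in
  let e := phi (w, x.2.2) in
  (e, (w, if e is Some _ then x.2.2.+1 else x.2.2)).

Lemma eff_transduce : effective transduce.
Proof.
have Hw : effective (fun x : bool * (seq bool * nat) => rcons x.2.1 x.1).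
  exact: eff_rcons (eff_fst (eff_snd eff_id)) (eff_fst eff_id).
have Hn : effective (fun x : bool * (seq bool * nat) => x.2.2).
  exact: eff_snd (eff_snd eff_id).
have He : effective (fun x : bool * (seq bool * nat) =>
    phi (rcons x.2.1 x.1, x.2.2)).
  exact: eff_comp (eff_pair Hw Hn) phi_eff.
apply: (eff_pair He (eff_pair Hw _)).
exact: (eff_match_option He Hn (eff_comp (eff_fst eff_id) (eff_succ Hn))).
Qed.

(** The code of [None] is 0 and that of [Some v] is v + 1. *)
Definition emit_entry : prog :=
  If 1 (Dec 1 ;; While 1 (Dec 1 ;; Emit true) ;; Emit false) Skip.

Lemma exec_emit_entry inp f k o (e : option nat) x :
  exec inp emit_entry (Memory (put f 0 [:: x; code e]) k o)
    (Memory (put f 0 [:: x]) k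
       (o ++ if e is Some v then rcons (nseq v true) false else [::])).
Proof.
have E0 : put f 0 [:: x] = put f 0 [:: x; 0].
  by apply: put_eq; case=> [|[|m]]; rewrite //= nth_nil.
apply: EIf => /=; case: e => [v|] /=; last by rewrite cats0 E0; exact: ESkip.
apply: EThen; first exact: EDec.
rewrite (upd_put f 0 _ 1) /=; apply: EThen; last first.
  rewrite -rcons_cat; exact: EEmit.
rewrite E0 /code /coding_nat; elim: v o => [|v IHv] o.
  by rewrite cats0; exact: EWhile0.
apply: EWhileS; first by [].
  by apply: EThen; [exact: EDec|exact: EEmit].
by rewrite (upd_put f 0 _ 1) /= -cat_rcons; exact: IHv.
Qed.

Fixpoint emitted_count (p : baire) (N : nat) : nat :=
  if N is N'.+1 then
    let n := emitted_count p N' in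
    if phi (mkseq (word p) N, n) is Some _ then n.+1 else n
  else 0.

(** The machine repeats forever: read a bit, update the coded state, write the
    entry proposed, if any. Every proposal is required to be correct, and
    proposals for entry n to occur arbitrarily late, as the machine asks for
    entry n only after having written the previous ones. *)
Theorem transducer : exists M : machine, forall p q : baire,
  (forall N n v, phi (mkseq (word p) N, n) = Some v -> v = q n) ->
  (forall n N, exists2 N', N <= N' & phi (mkseq (word p) N', n) != None) ->
  computes M p q.
Proof.
have [h Hh hT] := eff_transduce; have [P HP] := primrec_program Hh.
pose body := Read 1 ;; pairer 0 ;; P 0 ;; unpairer 0 ;; emit_entry.
pose prg := compile 0 body ++ [:: IGoto 0].
exists (counter_machine prg) => p q sound progress.
pose (mem N := Memory (put (fun=> 0) 0
    [:: code (mkseq (word p) N, emitted_count p N)]) N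
  (word_prefix q (emitted_count p N))).
have round N : exec (word p) body (mem N) (mem N.+1).
  apply: EThen; first exact: ERead.
  rewrite -[1](add0n 1) upd_put put_nth addn0 /=.
  apply: EThen; first exact: runs_pairer.
  apply: EThen; first exact: HP.
  apply: EThen; first exact: runs_unpairer.
  set n := emitted_count p N; set w := mkseq (word p) N.
  have -> : npair (word p N) (code (w, n)) = code (word p N, (w, n)) by [].
  rewrite hT /transduce /= -mkseqS; set e := phi _.
  have -> : mem N.+1 = Memory (put (fun=> 0) 0
      [:: code (mkseq (word p) N.+1, if e is Some _ then n.+1 else n)]) N.+1
    (word_prefix q n ++
      if e is Some v then rcons (nseq v true) false else [::]).
    rewrite /mem /= -/n -/e; congr Memory.
    case E: e => [v|]; last by rewrite cats0.
    by rewrite (sound _ _ _ E) word_prefixS.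
  rewrite npairK1 npairK2; exact: exec_emit_entry.
have at0 : located prg 0 (compile 0 body) by exact: located_prefix.
have goto0 : onth prg (prog_size body) = Some (IGoto 0).
  by rewrite -(size_compile 0); exact: onth_size_cat.
have reach N :
    exists t, run (counter_machine prg) p t = mem_config prg 0 (mem N).
  elim: N => [|N [t Et]].
    exists 1; rewrite /run /= /step /=; congr Config.
    - by apply/funext => i; apply/funext => n; case: n.
    - apply/funext => i /=; rewrite /put subn0.
      by case: (nat_of_ord i) => [|[|m]].
  have := compile_correct (round N) at0.
  move=> /reaches_trans/(_ (reaches_instr (word p) (mem N.+1) goto0)) [t' Et'].
  by exists (t' + t); rewrite /run iterD -/(run _ p t) Et.
have count_mono N N' : N <= N' -> emitted_count p N <= emitted_count p N'.
  move=> /subnK <-; elim: (N' - N) => // m IHm; apply: leq_trans IHm _.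
  by rewrite /=; case: (phi _).
have count_unbounded n : exists N, n <= emitted_count p N.
  elim: n => [|n [N nN]]; first by exists 0.
  have [[|N'] NN' Hphi] := progress n N.+1; first by [].
  exists N'.+1; move: nN => /leq_trans/(_ (count_mono N N' NN')).
  rewrite leq_eqVlt => /orP[/eqP En|ltn].
    by rewrite /= -En; case: (phi _) Hphi.
  exact: leq_trans ltn (count_mono _ _ (leqnSn _)).
move=> n; have [N nN] := count_unbounded n; have [t Et] := reach N.
by exists t; rewrite Et /=; exact: prefix_word_prefix.
Qed.

End Transducer.

(** * Reading entries of Baire space off a word *)

Definition scan_entry (a : seq nat * nat) (b : bool) : seq nat * nat :=
  if b then (a.1, a.2.+1) else (rcons a.1 a.2, 0).

(** The entries completed in a word 1^a 0 1^b 0 ...; a last block without its 0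
    is not an entry. *)
Definition entries (w : seq bool) : seq nat := (foldl scan_entry ([::], 0) w).1.

Lemma eff_entries C {_ : coding C} (w : C -> seq bool) :
  effective w -> effective (fun c => entries (w c)).
Proof.
move=> Hw; apply: eff_fst; apply: (@eff_foldl _ _ _ _ _ _ w (fun=> ([::], 0))
  (fun x : C * ((seq nat * nat) * bool) => scan_entry x.2.1 x.2.2)) => //.
  exact: eff_const.
have H1 : effective (fun x : C * ((seq nat * nat) * bool) => x.2.1.1).
  exact: eff_fst (eff_fst (eff_snd eff_id)).
have H2 : effective (fun x : C * ((seq nat * nat) * bool) => x.2.1.2).
  exact: eff_snd (eff_fst (eff_snd eff_id)).
have Hb : effective (fun x : C * ((seq nat * nat) * bool) => x.2.2).
  exact: eff_snd (eff_snd eff_id).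
exact: eff_if Hb (eff_pair H1 (eff_succ H2))
  (eff_pair (eff_rcons H1 H2) (eff_const 0)).
Qed.

Lemma prefix_entries v w : prefix v w -> prefix (entries v) (entries w).
Proof.
move=> /prefixP[u ->]; rewrite /entries foldl_cat.
elim: u (foldl _ _ v) => [|b u IHu] a; first exact: prefix_refl.
apply: prefix_trans (IHu _).
by case: b; [exact: prefix_refl|exact: prefix_rcons].
Qed.

Lemma entries_word_prefix p n : entries (word_prefix p n) = mkseq p n.
Proof.
rewrite /entries.
suff -> : foldl scan_entry ([::], 0) (word_prefix p n) = (mkseq p n, 0) by [].
elim: n => // n IHn; rewrite word_prefixS foldl_cat IHn foldl_rcons mkseqS.
suff -> s k m : foldl scan_entry (s, k) (nseq m true) = (s, k + m) by [].
by elim: m k => [|m IHm] k; rewrite ?addn0 //= IHm addSnnS.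
Qed.

(** Covers at once a point read bit by bit and the output of a machine
    computing it, stage by stage. *)
Definition exhausts (o : nat -> seq bool) (p : baire) : Prop :=
  (forall s t, s <= t -> prefix (o s) (o t)) /\
  (forall n, exists t, prefix (word_prefix p n) (o t)).

Lemma exhausts_run M p q : computes M p q ->
  exhausts (fun t => output (run M p t)) q.
Proof. by move=> Mpq; split=> // s t; exact: prefix_output_run. Qed.

Lemma mkseq_split T (f : nat -> T) (m n : nat) : m <= n ->
  mkseq f n = mkseq f m ++ [seq f i | i <- iota m (n - m)].
Proof. by move=> mn; rewrite /mkseq -map_cat -iotaD subnKC. Qed.

Lemma exhausts_word p : exhausts (mkseq (word p)) p.
Proof.
split=> [s t st|n]; first by rewrite (mkseq_split _ st) prefix_prefix.
exists (size (word_prefix p n)).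
suff -> : mkseq (word p) (size (word_prefix p n)) = word_prefix p n.
  exact: prefix_refl.
apply: (@eq_from_nth _ false); rewrite size_mkseq // => i i_lt.
by rewrite nth_mkseq // nth_word_prefix.
Qed.

(** A stage o t is comparable with every prefix of the word of p, because both
    are prefixes of a later stage; so all that is read off it is correct. *)
Lemma exhausts_entries o p t : exhausts o p ->
  entries (o t) = mkseq p (size (entries (o t))).
Proof.
move=> [mono cover]; have [t' pt'] := cover (size (o t)).
pose T := maxn t t'; set w := word_prefix p (size (o t)).
have oT : prefix (o t) w.
  have /prefixP[u Eu] : prefix (o t) (o T) by apply: mono; exact: leq_maxl.
  have /prefixP[v Ev] : prefix w (o T).
    by apply: prefix_trans pt' (mono _ _ _); exact: leq_maxr.
  have Ew : w = take (size w) (o T) by rewrite Ev take_size_cat.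
  by rewrite prefixE Ew take_takel ?size_word_prefix // Eu take_size_cat.
have := prefix_entries oT; rewrite entries_word_prefix => pre.
have := size_prefix pre; rewrite size_mkseq => le_n.
move: pre; rewrite prefixE => /eqP {1}<-.
by rewrite /mkseq -map_take take_iota (minn_idPl le_n).
Qed.

Lemma exhausts_nth o p t n : exhausts o p -> n < size (entries (o t)) ->
  nth 0 (entries (o t)) n = p n.
Proof. by move=> Hop n_lt; rewrite (exhausts_entries t Hop) nth_mkseq. Qed.

Lemma exhausts_size o p n : exhausts o p ->
  exists t0, forall t, t0 <= t -> n <= size (entries (o t)).
Proof.
move=> [mono cover]; have [t0 pt0] := cover n; exists t0 => t t0t.
have /prefix_entries/size_prefix := prefix_trans pt0 (mono _ _ t0t).
by rewrite entries_word_prefix size_mkseq.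
Qed.

Definition seen (M : machine) (w : seq bool) : seq nat :=
  entries (output_on M w (size w)).

Lemma seen_word M p N :
  seen M (mkseq (word p) N) = entries (output (run M p N)).
Proof. by rewrite /seen size_mkseq output_run_mkseq. Qed.

Lemma eff_seen M C {_ : coding C} (w : C -> seq bool) :
  effective w -> effective (fun c => seen M (w c)).
Proof. by move=> Hw; exact: eff_entries (eff_output_on M Hw (eff_size Hw)). Qed.

Lemma total_subproof A B (E : A -> B) a : is_subset1 [set b | E a = b].
Proof. by move=> b b' /= <- <-. Qed.

Definition total A B (E : A -> B) : pfun A B := PFun (@total_subproof A B E).

Lemma computable_total (E : seq bool * nat -> nat) : effective E ->
  computable
    (total (fun p : baire => (fun n => E (mkseq (word p) n.+1, n)) : baire)).
Proof.
move=> EE.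
pose phi (x : seq bool * nat) : option nat :=
  if x.2 < size x.1 then Some (E (mkseq (nth false x.1) x.2.+1, x.2)) else None.
have Hw : effective (fun x : seq bool * nat => x.1) by exact: eff_fst eff_id.
have Hn : effective (fun x : seq bool * nat => x.2) by exact: eff_snd eff_id.
have phi_eff : effective phi.
  apply: eff_if; last exact: eff_const.
    exact: eff_leq (eff_succ Hn) (eff_size Hw).
  apply: eff_some; apply: eff_comp EE; apply: (eff_pair _ Hn).
  apply: (@eff_mkseq _ _ _ _
    (fun z : (seq bool * nat) * nat => nth false z.1.1 z.2)).
    exact: eff_nth (eff_comp (eff_fst eff_id) Hw) (eff_snd eff_id).
  exact: eff_succ.
have [M HM] := transducer phi_eff; exists M => p q /= <-.
apply: HM => [N n v|n N].
  rewrite /phi size_mkseq /=; case: ltnP => // nN [<-].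
  congr (E (_, _)); apply/eq_in_map => i.
  rewrite mem_iota add0n ltnS => /andP[_ le_in].
  by rewrite nth_mkseq // (leq_ltn_trans le_in).
exists (maxn N n.+1); first exact: leq_maxl.
by rewrite /phi /= size_mkseq leq_max ltnSn orbT.
Qed.

(** Each entry of the result depends on a single entry of the argument. Both
    pieces of the reduction of limits to choice have this form. *)
Definition query (i : nat -> nat) (g : nat * nat -> nat) (q : baire) : baire :=
  fun x => g (x, q (i x)).

(** The reader [rd] extracts the known entries of q from the input bits: of q
    itself ([computable_query]) or of the output of a machine on the input
    ([computable_query_after]). *)
Lemma query_machine (rd : seq bool -> seq nat) (i : nat -> nat)
    (g : nat * nat -> nat) :
  effective rd -> effective i -> effective g ->
  exists M : machine, forall p q o, exhausts o q ->
    (forall N, rd (mkseq (word p) N) = entries (o N)) ->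
    computes M p (query i g q).
Proof.
move=> Hrd Hi Hg.
pose phi (x : seq bool * nat) : option nat :=
  if i x.2 < size (rd x.1) then Some (g (x.2, nth 0 (rd x.1) (i x.2)))
  else None.
have Hr : effective (fun x : seq bool * nat => rd x.1).
  exact: eff_comp (eff_fst eff_id) Hrd.
have Hn : effective (fun x : seq bool * nat => x.2) by exact: eff_snd eff_id.
have Hin : effective (fun x : seq bool * nat => i x.2) by exact: eff_comp Hn Hi.
have phi_eff : effective phi.
  apply: eff_if; last exact: eff_const.
    exact: eff_leq (eff_succ Hin) (eff_size Hr).
  exact: eff_some (eff_comp (eff_pair Hn (eff_nth 0 Hr Hin)) Hg).
have [M HM] := transducer phi_eff; exists M => p q o oq rdE.
apply: HM => [N n v|n N]; rewrite /phi /=.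
  by rewrite rdE; case: ifP => // i_lt [<-]; rewrite (exhausts_nth oq).
have [t0 Ht0] := exhausts_size (i n).+1 oq.
exists (maxn N t0); first exact: leq_maxl.
by rewrite rdE Ht0 // leq_maxr.
Qed.

Lemma computable_query i g : effective i -> effective g ->
  computable (total (query i g)).
Proof.
move=> Hi Hg; have [M HM] := query_machine (eff_entries eff_id) Hi Hg.
by exists M => p _ /= <-; apply: HM (exhausts_word p) _.
Qed.

Lemma computable_query_after F i g :
  computable F -> effective i -> effective g ->
  computable (pcomp (total (query i g)) F).
Proof.
move=> [M MF] Hi Hg; have [M' HM'] := query_machine (eff_seen M eff_id) Hi Hg.
exists M' => p _ /= [q Fpq <-]; apply: HM' (exhausts_run (MF _ _ Fpq)) _ => N.
exact: seen_word.
Qed.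

Local Open Scope classical_set_scope.

(** * Convergence in Baire space *)

Lemma lim_baireP (p q : baire) : lim_baire p q <->
  forall j, exists N, forall i, N <= i -> component p i j = q j.
Proof.
split=> [cvg_pq j|H].
  have pj : (proj j \o component p) @ \oo --> q j.
    exact: (cvg_comp _ _ cvg_pq (@proj_continuous nat (fun=> nat) j q)).
  move: pj; rewrite discrete_cvg.
  by move=> [N _ HN]; exists N => i Ni; exact: (HN i Ni).
apply/cvg_sup => j U [B [[C oC <-] Cq] BU].
apply: filterS BU _; have [N HN] := H j.
by exists N => // i /= Ni; rewrite HN.
Qed.

Definition eventually_eq (a : nat -> baire) (q : baire) : Prop :=
  forall m, exists N0, forall N, N0 <= N -> a N m = q m.

Lemma eventually_eq_below a q : eventually_eq a q -> forall t,
  exists N0, forall N, N0 <= N -> forall m, m < t -> a N m = q m.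
Proof.
move=> aq; elim=> [|t [N0 HN0]]; first by exists 0.
have [N1 HN1] := aq t; exists (maxn N0 N1) => N.
rewrite geq_max => /andP[N0N N1N] m; rewrite ltnS leq_eqVlt => /orP[/eqP->|mt].
  exact: HN1.
exact: HN0.
Qed.

(** * From limit computability to parallel choice *)

(** Position x = <j, <i, n>> of the enumeration decides whether entry i of
    coordinate j is evidence against n = <k, v> as a member of A_j. *)
Definition removal_index (x : nat) : nat := npair (nfst (nsnd x)) (nfst x).

Definition removal_entry (x : nat * nat) : nat :=
  let n := nsnd (nsnd x.1) in
  if (nfst n <= nfst (nsnd x.1)) && (x.2 != nsnd n) then n.+1 else 0.

Definition removals : baire -> baire := query removal_index removal_entry.

(** In a name r of the sequence of answers, entry <j, 0> is the answer for the
    j-th set; it sits at the odd position 2 <j, 0> + 1 of <p, r>. *)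
Definition limit_index (j : nat) : nat := (npair j 0 + npair j 0).+1.

Definition limit_values : baire -> baire :=
  query limit_index (fun x => nsnd x.2).

Lemma eff_removal_index : effective removal_index.
Proof. exact: eff_npair (eff_nfst (eff_nsnd eff_id)) (eff_nfst eff_id). Qed.

Lemma eff_removal_entry : effective removal_entry.
Proof.
have Hn : effective (fun x : nat * nat => nsnd (nsnd x.1)).
  exact: eff_nsnd (eff_nsnd (eff_fst eff_id)).
apply: eff_if; [|exact: eff_succ|exact: eff_const].
apply: eff_andb.
  exact: eff_leq (eff_nfst Hn) (eff_nfst (eff_nsnd (eff_fst eff_id))).
exact: eff_negb (eff_eqn (eff_snd eff_id) (eff_nsnd Hn)).
Qed.

Lemma eff_limit_index : effective limit_index.
Proof.
have H : effective (fun j => npair j 0).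
  exact: eff_npair eff_id (eff_const 0).
exact: eff_succ (eff_add H H).
Qed.

Lemma range_removals (q : baire) j n :
  range (component (removals q) j) n.+1 <->
  exists2 i, nfst n <= i & component q i j <> nsnd n.
Proof.
have E m : component (removals q) j m =
    if (nfst (nsnd m) <= nfst m) && (q (npair (nfst m) j) != nsnd (nsnd m))
    then (nsnd m).+1 else 0.
  by rewrite /component /removals /query /removal_index /removal_entry
    -[Cantor.to_nat _]/(npair j m) !npairK1 !npairK2.
split=> [[m _]|[i ni /eqP qi]].
  rewrite E; case: ifP => // /andP[ni /eqP qi] [<-]; exists (nfst m) => //.
exists (npair i n) => //; rewrite E !npairK1 !npairK2 ni.
by rewrite (_ : q (npair i j) != nsnd n).
Qed.

Lemma pairing_odd (p q : baire) n : pairing p q (n + n).+1 = q n.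
Proof. by rewrite /pairing /= oddD addbb /= addnn uphalf_double. Qed.

Lemma limit_computable_weihrauch (X Y : represented_space) (f : mfun X Y) :
  limit_computable f -> weihrauch_le f (parallelization closed_choice_nat).
Proof.
move=> [F compF realF].
exists (total limit_values), (pcomp (total removals) F); split.
- exact: computable_query eff_limit_index (eff_nsnd (eff_snd eff_id)).
- exact: computable_query_after compF eff_removal_index eff_removal_entry.
move=> G realG p x px fx.
have [q Fpq [y [l /lim_baireP ql ly] fxy]] := realF p x px fx.
pose A j : set nat := [set n | ~ range (component (removals q) j) n.+1].
have A_mem j n : A j n <-> forall i, nfst n <= i -> component q i j = nsnd n.
  split=> [nA i ni|H /range_removals[i ni]]; last by rewrite H.
  by apply: contrapT => qi; apply: nA; apply/range_removals; exists i.
have A_name : rep (seq_space closed_nat_space) (removals q) A by [].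
have A_dom : mdom (parallelization closed_choice_nat) A.
  have /choice[k Hk] := ql.
  exists (fun j => npair (k j) (l j)) => j; apply/A_mem => i.
  by rewrite npairK1 npairK2; exact: Hk.
have [r Gr [c rc Ac]] := realG _ _ A_name A_dom.
exists l; last by exists y.
exists r; first by exists (removals q) => //; exists q.
rewrite /= /limit_values /query; apply/funext => j.
rewrite /limit_index pairing_odd.
have -> : r (npair j 0) = c j by exact: rc.
have [N HN] := ql j.
rewrite -(HN (maxn N (nfst (c j))) (leq_maxl _ _)).
by apply/esym; move/A_mem: (Ac j); apply; exact: leq_maxr.
Qed.

(** * From parallel choice to limit computability *)

Section Stages.
Variables MK MH : machine.

Definition approx_point (w : seq bool) : baire := nth 0 (entries w).

(** The least value not removed so far; the search is cut off at the stage,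
    which makes no difference in the limit. *)
Definition approx_choice (w : seq bool) : baire := fun m =>
  find (fun v => ~~ has (fun l => (nfst l == nfst m) &&
      (nth 0 (seen MH w) l == v.+1)) (iota 0 (size (seen MH w))))
    (iota 0 (size w)).

Definition stage_output (w : seq bool) : seq nat :=
  entries
    (output (run MK (pairing (approx_point w) (approx_choice w)) (size w))).

Definition stage_entry (x : seq bool * nat) : nat :=
  nth 0 (stage_output x.1) (nsnd x.2).

(** Entry n = <i, j> is entry j of the i-th point of the sequence. It is
    computed at stage n + 1, which tends to infinity with i. *)
Definition stages (p : baire) : baire :=
  fun n => stage_entry (mkseq (word p) n.+1, n).

Lemma eff_stage_entry : effective stage_entry.
Proof.
apply: eff_nth; last exact: eff_nsnd (eff_snd eff_id).
have H : effective stage_output; last exact: eff_comp (eff_fst eff_id) H.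
apply: eff_entries.
under eq_fun do rewrite output_run.
apply: eff_output_on; last exact: eff_size eff_id.
apply: eff_word_prefix; last exact: eff_size eff_id.
set T := (seq bool * nat)%type.
apply: (@eff_pairing T _ (fun x => approx_point x.1)
  (fun x => approx_choice x.1) (fun x => x.2)); last exact: eff_snd eff_id.
  exact: eff_nth (eff_entries (eff_fst (eff_fst eff_id))) (eff_snd eff_id).
have Hh : effective (fun x : T * nat * nat * nat => seen MH x.1.1.1.1).
  exact: eff_seen (eff_fst (eff_fst (eff_fst (eff_fst eff_id)))).
have Hl : effective (fun x : T * nat * nat * nat => x.2).
  exact: eff_snd eff_id.
have Hm : effective (fun x : T * nat * nat * nat => nfst x.1.1.2).
  exact: eff_nfst (eff_snd (eff_fst (eff_fst eff_id))).
have Hv : effective (fun x : T * nat * nat * nat => x.1.2).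
  exact: eff_snd (eff_fst eff_id).
have Hh' : effective (fun x : T * nat * nat => iota 0 (size (seen MH x.1.1.1))).
  apply: eff_iota; first exact: eff_const.
  apply: eff_size; exact: eff_seen (eff_fst (eff_fst (eff_fst eff_id))).
apply: (@eff_find _ _ _ _ (fun x : T * nat => iota 0 (size x.1.1))
  (fun z : T * nat * nat => ~~ has (fun l => (nfst l == nfst z.1.2) &&
    (nth 0 (seen MH z.1.1.1) l == z.2.+1)) (iota 0 (size (seen MH z.1.1.1))))).
  exact: eff_iota (eff_const 0) (eff_size (eff_fst (eff_fst eff_id))).
apply: eff_negb.
apply: (@eff_has _ _ _ _
  (fun z : T * nat * nat => iota 0 (size (seen MH z.1.1.1)))
  (fun x : T * nat * nat * nat => (nfst x.2 == nfst x.1.1.2) &&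
    (nth 0 (seen MH x.1.1.1.1) x.2 == x.1.2.+1))) => //.
apply: eff_andb; first exact: eff_eqn (eff_nfst Hl) Hm.
exact: eff_eqn (eff_nth 0 Hh Hl) (eff_succ Hv).
Qed.

End Stages.

(** A name of a sequence of numbers may have anything after the first entry of
    each component; repeating the least element there makes the choice
    single-valued. *)
Definition least_choice (r s : baire) : Prop := forall m,
  ~ range (component r (nfst m)) (s m).+1 /\
  forall v, v < s m -> range (component r (nfst m)) v.+1.

Lemma least_choice_fun r : is_subset1 (least_choice r).
Proof.
move=> s s' H H'; apply/funext => m; apply/eqP.
have [[ns ls] [ns' ls']] := (H m, H' m).
rewrite eqn_leq; apply/andP; split; rewrite leqNgt; apply/negP.
  by move=> /ls.
by move=> /ls'.
Qed.

Definition least_choice_pfun : pfun baire baire := PFun least_choice_fun.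

Lemma realizer_least_choice :
  realizer least_choice_pfun (parallelization closed_choice_nat).
Proof.
move=> r A rA [y Ay].
have Aj j n : A j n <-> ~ range (component r j) n.+1 by rewrite (rA j).
have least j : exists n, ~ range (component r j) n.+1 /\
    forall v, v < n -> range (component r j) v.+1.
  have exA : exists n, `[< A j n >] by exists (y j); apply/asboolP/Ay.
  exists (ex_minn exA); case: ex_minnP => n /asboolP/Aj nA n_min.
  split=> // v vn.
  apply: contrapT => /Aj Av; suff : n <= v by rewrite leqNgt vn.
  by apply: n_min; apply/asboolP.
have [c cP] := choice least.
exists (tupling (fun j _ => c j)).
  move=> m; rewrite /tupling; move: (cP (nfst m)); rewrite /nfst.
  by case: (Cantor.of_nat m).
exists c => j; first by rewrite tuplingK.
by apply/Aj; case: (cP j).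
Qed.

Lemma find_iota (a : pred nat) n m :
  (forall v, v < n -> ~~ a v) -> a n -> n < m -> find a (iota 0 m) = n.
Proof.
move=> Hlt an nm; apply/eqP; rewrite eqn_leq; apply/andP; split; rewrite leqNgt.
  apply/negP => /(before_find 0); by rewrite nth_iota // add0n an.
have a_find : has a (iota 0 m) by apply/hasP; exists n; rewrite // mem_iota.
apply/negP => /Hlt/negP; apply.
have := nth_find 0 a_find; rewrite nth_iota ?add0n //.
by rewrite -[X in _ < X](size_iota 0) -has_find.
Qed.

Lemma approx_point_lim p :
  eventually_eq (fun N => approx_point (mkseq (word p) N)) p.
Proof.
move=> m; have [N0 HN0] := exhausts_size m.+1 (exhausts_word p).
by exists N0 => N /HN0; exact: (exhausts_nth (exhausts_word p)).
Qed.

(** Once the finitely many positions where the numbers below the least element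
    get removed have been seen, the guess is right, and it stays right because
    the least element is never removed. *)
Lemma approx_choice_lim MH p b r : computes MH p b -> least_choice b r ->
  eventually_eq (fun N => approx_choice MH (mkseq (word p) N)) r.
Proof.
move=> Mpb br m; have [nr lr] := br m.
have oE := exhausts_run Mpb.
have /choice[l Hl] : forall v, exists l, v < r m ->
    component b (nfst m) l = v.+1.
  move=> v; have [/lr[l _ Hl]|_] := boolP (v < r m); first by exists l.
  by exists 0.
pose B := (\max_(v < r m) npair (nfst m) (l v)).+1.
have [N0 HN0] := exhausts_size B oE.
exists (maxn N0 (r m).+1) => N; rewrite geq_max => /andP[N0N rN].
rewrite /approx_choice size_mkseq seen_word; set h := entries _.
have hE k : k < size h -> nth 0 h k = b k by exact: (exhausts_nth oE).
apply: find_iota rN => [v vr|]; last first.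
  apply/hasPn => k; rewrite mem_iota add0n => /andP[_ kh].
  apply/negP => /andP[/eqP km]; rewrite hE // => /eqP bk.
  apply: nr; exists (nsnd k) => //; rewrite -bk -km /component.
  by rewrite /nfst /nsnd -surjective_pairing Cantor.cancel_to_of.
have l_seen : npair (nfst m) (l v) < size h.
  apply: leq_trans (HN0 N N0N); rewrite ltnS.
  pose F (u : 'I_(r m)) := npair (nfst m) (l u).
  exact: (@leq_bigmax _ F (Ordinal vr)).
rewrite negbK; apply/hasP; exists (npair (nfst m) (l v)).
  by rewrite mem_iota add0n.
by rewrite npairK1 eqxx /= hE //; apply/eqP; exact: Hl.
Qed.

Lemma word_prefix_eq (p q : baire) n :
  (forall m, m < n -> p m = q m) -> word_prefix p n = word_prefix q n.
Proof.
move=> pq; rewrite /word_prefix; congr flatten; apply/eq_in_map => i.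
by rewrite mem_iota => /andP[_ i_lt]; rewrite pq.
Qed.

(** If M has written the required entries of s after t0 steps on q, it has read
    at most t0 bits; from the stage on at which a N agrees with q so far, its
    first t0 steps on a N are the same, and more steps only extend the
    output. *)
Lemma run_continuous M (a : nat -> baire) (q s : baire) :
  eventually_eq a q -> computes M q s ->
  eventually_eq (fun N => nth 0 (entries (output (run M (a N) N)))) s.
Proof.
move=> aq Mqs j; have oE := exhausts_run Mqs.
have [t0 Ht0] := exhausts_size j.+1 oE.
have [N0 HN0] := eventually_eq_below aq t0.
exists (maxn N0 t0) => N; rewrite geq_max => /andP[N0N t0N].
have Erun : output (run M (a N) t0) = output (run M q t0).
  by rewrite !output_run (word_prefix_eq (HN0 N N0N)).
have := prefix_entries (prefix_output_run M (a N) t0N).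
rewrite Erun => /nth_prefix ->; last exact: Ht0.
by rewrite (exhausts_nth oE) // Ht0.
Qed.

Lemma eventually_eq_pairing a a' p q :
  eventually_eq a p -> eventually_eq a' q ->
  eventually_eq (fun N => pairing (a N) (a' N)) (pairing p q).
Proof. by move=> ap aq m; rewrite /pairing; case: (odd m). Qed.

Lemma stages_lim MK MH p b r s :
  computes MH p b -> least_choice b r -> computes MK (pairing p r) s ->
  lim_baire (stages MK MH p) s.
Proof.
move=> Hb br Ks; apply/lim_baireP => j.
have aE := eventually_eq_pairing (approx_point_lim p) (approx_choice_lim Hb br).
have [N0 HN0] := run_continuous aE Ks j.
exists N0 => i N0i; set w := mkseq (word p) (npair i j).+1.
transitivity (nth 0 (stage_output MK MH w) (nsnd (npair i j))); first by [].
rewrite npairK2 /stage_output.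
have := HN0 (npair i j).+1 (leqW (leq_trans N0i (npair_ge_fst i j))).
by rewrite /w size_mkseq.
Qed.

Lemma weihrauch_limit_computable (X Y : represented_space) (f : mfun X Y) :
  weihrauch_le f (parallelization closed_choice_nat) -> limit_computable f.
Proof.
move=> [K [H [[MK HK] [MH HH] real]]].
exists (total (stages MK MH)).
  exact: computable_total (eff_stage_entry MK MH).
move=> p x px fx; exists (stages MK MH p); first by [].
have [s [r [b Hpb br] Ks] [y sy fxy]] := real _ realizer_least_choice p x px fx.
exists y => //; exists s => //.
exact: stages_lim (HH _ _ Hpb) br (HK _ _ Ks).
Qed.

Theorem corollary7p15 (X Y : represented_space) (f : mfun X Y) :
  weihrauch_le f (parallelization closed_choice_nat) <-> limit_computable f.
Proof.
split; [exact: weihrauch_limit_computable|exact: limit_computable_weihrauch].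
Qed.
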